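(* Consider a family of EC3 instances indexed by the number of bits $N\to\infty$, with $M$ clauses where $M$ grows at most polynomially with $N$, together with a choice of $m$ pairwise disjoint clauses ($m$ may depend on $N$). Let $F$, $L=|F|=2^N(3/8)^m$, $|F\rangle$, $\mathcal H_F$, $R_F$, $C_F=\sum_{x\in F}E_x|x\rangle\langle x|$ and $R=\max_{x\in F}E_x$ be as defined in the context, and let $$H_F(s)=(1-s)R_F+sC_F,\qquad 0\le s\le 1,$$ acting on $\mathcal H_F$. Assume $C_F$ has a unique zero-cost state $x_\star\in F$, so $E_{x_\star}=0$ and $E_x\ge1$ for $x\in F\setminus\{x_\star\}$. Define $$A_k=\frac1L\sum_{x\in F\setminus\{x_\star\}}E_x^{-k},\qquad k=1,2.$$ Then the minimum $g_{\min}$ over $s\in[0,1]$ of the gap between the lowest two eigenvalues of $H_F(s)$ satisfies, as $N\to\infty$, $$g_{\min}=\frac{2A_1}{1+A_1}\,\frac{1}{\sqrt{A_2L}}\,(1+o(1)).$$ Equivalently, with $$q_N=\frac{2A_1}{(1+A_1)\sqrt{A_2}},\qquad \frac{L-1}{LR}\le q_N\le 2,$$ one has $$g_{\min}=q_N\,2^{-N/2}\left(\frac83\right)^{m/2}(1+o(1)).$$ Since $R\le4(M-m)$ grows at most polynomially with $N$, $q_N$ lies between an inverse polynomial in $N$ and a constant.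
   Context: Exact Cover 3 (EC3): an instance on $N$ bits has clauses $a=1,\dots,M$, each acting on three distinct bits $i_a,j_a,k_a\in\{1,\dots,N\}$; a clause is satisfied by $x\in\{0,1\}^N$ when exactly one of $x_{i_a},x_{j_a},x_{k_a}$ equals one. The cost is $$C_{\mathrm{EC3}}(x)=\sum_{a=1}^M(x_{i_a}+x_{j_a}+x_{k_a}-1)^2 .$$ Let $I$ be the chosen set of $m$ clauses that are pairwise disjoint (no two share a bit; thus $m\le N/3$), and let $$F=\Big\{x\in\{0,1\}^N:\ \sum_{a\in I}(x_{i_a}+x_{j_a}+x_{k_a}-1)^2=0\Big\},$$ so that $L=|F|=3^m2^{N-3m}=2^N(3/8)^m$. Let $\mathcal H_F=\operatorname{span}\{|x\rangle:x\in F\}$, where $|x\rangle$ are the computational basis vectors of $(\mathbb C^2)^{\otimes N}$, and $|F\rangle=L^{-1/2}\sum_{x\in F}|x\rangle$. On $\mathcal H_F$ put $R_F=\mathbb I-|F\rangle\langle F|$, and let $C_F=\sum_{x\in F}E_x|x\rangle\langle x|$ with $E_x=C_{\mathrm{EC3}}(x)$ be the EC3 cost Hamiltonian (diagonal in the computational basis) restricted to $\mathcal H_F$. Set $R=\max_{x\in F}E_x$; the $E_x$ are nonnegative integers. Eigenvalues are counted with multiplicity, and $o(1)$ denotes a quantity tending to $0$ as $N\to\infty$ along the family. *)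

(* Defs.v *)
From HB Require Import structures.
From mathcomp Require Import all_boot all_order all_algebra.
From mathcomp Require Import all_classical all_reals all_analysis.
From mathcomp Require Import complex spectral.

Set Implicit Arguments.
Unset Strict Implicit.
Unset Printing Implicit Defensive.

Import Order.TTheory GRing.Theory Num.Theory.
Import numFieldNormedType.Exports.

Local Open Scope ring_scope.
Local Open Scope complex_scope.
Local Open Scope sesquilinear_scope.

Definition bits (N : nat) : finType := {ffun 'I_N -> bool}.

Record clause (N : nat) := Clause {
  bit_i : 'I_N;
  bit_j : 'I_N;
  bit_k : 'I_N;
  clause_uniq : uniq [:: bit_i; bit_j; bit_k] }.

Definition clause_bits (N : nat) (c : clause N) : {set 'I_N} :=
  [set bit_i c; bit_j c; bit_k c]%SET.

(* Computed in [int]: the difference is -1 when all three bits are 0. *)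
Definition clause_cost (N : nat) (c : clause N) (x : bits N) : int :=
  ((x (bit_i c) : nat)%:Z + (x (bit_j c) : nat)%:Z + (x (bit_k c) : nat)%:Z
     - 1) ^+ 2.

Section Instance.
Variables (N M : nat) (cl : 'I_M -> clause N) (I : {set 'I_M}).

Definition pairwise_disjoint : Prop :=
  forall a b : 'I_M, a \in I -> b \in I -> a != b ->
    [disjoint clause_bits (cl a) & clause_bits (cl b)].

Definition cost (x : bits N) : int := \sum_(a < M) clause_cost (cl a) x.

Definition feasible : {set bits N} :=
  [set x : bits N | \sum_(a in I) clause_cost (cl a) x == 0]%SET.

(* Costs are nonnegative, so the base value 0 does not affect the maximum. *)
Definition max_cost : int := \big[Num.max/0]_(x in feasible) cost x.

Definition unique_zero_cost (xs : bits N) : Prop :=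
  [/\ xs \in feasible, cost xs = 0
    & forall x, x \in feasible -> x != xs -> 1 <= cost x].

End Instance.

Section Hilbert.
Variables (R : realType) (N : nat) (F : {set bits N}).

(* Operators on H_F = span {|x> : x in F} are matrices in its orthonormal
   basis |x>, listed by [enum_val : 'I_#|F| -> bits N]. [ket x] is the
   coordinate vector of |x>, for x in F. *)
Definition ket (x : bits N) : 'cV[R[i]]_#|F| :=
  \col_(j < #|F|) (enum_val j == x)%:R.

Definition ketF : 'cV[R[i]]_#|F| :=
  ((Num.sqrt (#|F|%:R : R))^-1)%:C *: \sum_(x in F) ket x.

Definition ham_R : 'M[R[i]]_#|F| := 1%:M - ketF *m ketF ^t*.

Definition ham_C (E : bits N -> int) : 'M[R[i]]_#|F| :=
  \sum_(x in F) (E x)%:~R *: (ket x *m (ket x) ^t*).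

Definition ham (E : bits N -> int) (s : R) : 'M[R[i]]_#|F| :=
  (1 - s)%:C *: ham_R + s%:C *: ham_C E.

(* A_k = (1/|F|) * sum over x in F \ {xs} of E_x ^ (-k) *)
Definition inv_moment (E : bits N -> int) (xs : bits N) (k : nat) : R :=
  (#|F|%:R)^-1 * \sum_(x in F | x != xs) ((E x)%:~R : R) ^- k.

End Hilbert.

Local Open Scope classical_set_scope.

Section Spectrum.
Variables (R : realType) (n : nat).

(* Roots of the characteristic polynomial, with multiplicity, in nondecreasing
   order. Only applied to Hermitian matrices, whose roots are real, so taking
   real parts loses nothing. *)
Definition spectrum (A : 'M[R[i]]_n) : seq R :=
  sort <=%R [seq complex.Re z
            | z <- sval (closed_field_poly_normal (char_poly A))].

Definition gap (A : 'M[R[i]]_n) : R := (spectrum A)`_1 - (spectrum A)`_0.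

Definition min_gap (H : R -> 'M[R[i]]_n) : R :=
  inf [set gap (H s) | s in `[0, 1]].

End Spectrum.

Section Asymptotics.
Variable R : realType.

(* u = v (1 + o(1)) *)
Definition asymp_eq (u v : nat -> R) : Prop :=
  exists2 e : nat -> R, e n @[n --> \oo] --> (0 : R)
    & \forall n \near \oo, u n = v n * (1 + e n).

Definition poly_bounded (N : nat -> nat) (u : nat -> R) : Prop :=
  exists c d : nat, \forall n \near \oo, u n <= c%:R * (N n)%:R ^+ d.

Definition inv_poly_bounded_below (N : nat -> nat) (u : nat -> R) : Prop :=
  exists c d : nat, (0 < c)%N /\
    \forall n \near \oo, (c%:R * (N n)%:R ^+ d)^-1 <= u n.

End Asymptotics.

(* Main.v *)
Require Import Defs.
From HB Require Import structures.
From mathcomp Require Import all_boot all_order all_algebra.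
From mathcomp Require Import all_classical all_reals all_analysis.
From mathcomp Require Import complex spectral.
From mathcomp Require Import ring lra zify.

(* With e = 1 - s, the Hamiltonian is diag(e + s E_x) - e |F><F|, so e + s z is an
   eigenvalue with z not among the costs iff the secular equation
   phi(z) := (1/L) sum_x 1/(E_x - z) = s/(1 - s) holds. The two lowest levels are
   z = -a < 0 and z = b > 0 on either side of the pole at E = 0, and the gap is
   s (a + b). Put eps = 1/sqrt(A_2 L).
   Lower bound: the equation at -a gives s >= A_1/(1 + A_1 + a), and subtracting
   the two equations gives a b >= eps^2 (1 - b) when b < 1; since a + b >= 2 sqrt(a b)
   the gap is at least 2 A_1/(1 + A_1) eps (1 - O(eps)) for 0 < s < 1, and
   by Lipschitz continuity of the eigenvalues at the endpoints too.
   Upper bound: at s/(1 - s) = A_1 both a and b are at most eps (1 + O(eps)).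
   Finally eps -> 0 because L grows exponentially while the costs are polynomial. *)

Set Implicit Arguments.
Unset Strict Implicit.
Unset Printing Implicit Defensive.

Import Order.TTheory GRing.Theory Num.Theory.
Import numFieldNormedType.Exports.

Local Open Scope ring_scope.
Local Open Scope classical_set_scope.

(** * Low eigenvalues of Hermitian matrices *)

Section Spectral.
Local Open Scope complex_scope.
Local Open Scope sesquilinear_scope.
Variable R : realType.

Definition dot n (u v : 'cV[R[i]]_n) : R[i] := (u^t* *m v) 0 0.

Lemma dotE n (u v : 'cV[R[i]]_n) : dot u v = \sum_i Num.conj (u i 0) * v i 0.
Proof. by rewrite /dot mxE; apply: eq_bigr => i _; rewrite !mxE. Qed.

Lemma char_poly_diag_conj n (P D : 'M[R[i]]_n) : P \in unitmx ->
  char_poly (invmx P *m D *m P) = char_poly D.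
Proof.
move=> Pu; rewrite /char_poly.
have -> : char_poly_mx (invmx P *m D *m P) =
    map_mx polyC (invmx P) *m char_poly_mx D *m map_mx polyC P.
  rewrite /char_poly_mx mulmxBr mulmxBl -!map_mxM /=; congr (_ - _).
  by rewrite -mulmxA -scalar_mxC mulmxA -map_mxM mulVmx// map_scalar_mx/= mul1mx.
rewrite !det_mulmx mulrAC -det_mulmx -map_mxM mulVmx//.
by rewrite map_scalar_mx /= det_scalar expr1n mul1r.
Qed.

(** The factorization behind [spectrum] lists the roots in an unspecified order; equal products of
    linear factors give equal multisets, and sorting then fixes the order. *)
Lemma spectrum_diag n (A P : 'M[R[i]]_n) (d : 'rV[R[i]]_n) : P \in unitmx ->
    A = invmx P *m diag_mx d *m P ->
  spectrum A = sort <=%R [seq complex.Re (d 0 i) | i <- enum 'I_n].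
Proof.
move=> Pu ->; rewrite /spectrum char_poly_diag_conj//.
case: closed_field_poly_normal => rs /= rsE.
rewrite [X in _ = sort _ X](_ : _ = map (@complex.Re R) [seq d 0 i | i <- enum 'I_n]);
  last by rewrite -map_comp.
apply/perm_sortP; [exact: le_total|exact: le_trans|exact: le_anti|].
apply: perm_map; apply: prod_XsubC_eq.
move: rsE; rewrite (monicP (char_poly_monic _)) scale1r => <-.
rewrite char_poly_trig ?diag_mx_is_trig// big_map big_enum/=.
by apply: eq_bigr => i _; rewrite mxE eqxx mulr1n.
Qed.

Lemma size_spectrum n (A : 'M[R[i]]_n) : size (spectrum A) = n.
Proof.
rewrite /spectrum size_sort size_map; case: closed_field_poly_normal => rs /=.
rewrite (monicP (char_poly_monic _)) scale1r => /(congr1 (size : {poly _} -> _)).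
by rewrite size_char_poly size_prod_XsubC => -[].
Qed.

Lemma spectrum_nondecreasing n (A : 'M[R[i]]_n) j k :
  (j <= k)%N -> (k < n)%N -> (spectrum A)`_j <= (spectrum A)`_k.
Proof.
move=> jk kn; apply: (le_sorted_leq_nth 0) => //.
- by apply: sort_sorted; exact: le_total.
- by rewrite inE size_spectrum (leq_ltn_trans jk).
- by rewrite inE size_spectrum.
Qed.

(** Spectral theorem with the eigenvectors renumbered to follow the sorted spectrum; the Parseval
    and quadratic form expansions feed the variational bounds below. *)
Lemma spectrum_eigenbasis n (A : 'M[R[i]]_n) : A^t* = A ->
  exists u : 'I_n -> 'cV[R[i]]_n,
    [/\ forall j k, dot (u j) (u k) = (j == k)%:R,
        forall k, A *m u k = ((spectrum A)`_k)%:C *: u k,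
        forall v, dot v v = \sum_k `|dot (u k) v| ^+ 2
      & forall v, dot v (A *m v) =
          \sum_(k < n) ((spectrum A)`_k)%:C * `|dot (u k) v| ^+ 2].
Proof.
move=> Ah.
have Aherm : A \is hermsymmx.
  by apply/is_hermitianmxP; rewrite expr0 scale1r.
have An := hermitian_normalmx Aherm.
have AE := orthomx_spectralP An.
have Dr := hermitian_spectral_diag_real Aherm.
have Pun := spectral_unitarymx A.
have Pu := unitarymx_unit Pun.
set P := spectralmx A in AE Pun Pu; set d := spectral_diag A in AE Dr.
have PP : P *m P^t* = 1%:M by apply/unitarymxP.
have PP' : P^t* *m P = 1%:M by rewrite -invmx_unitary// mulVmx.
pose f i := complex.Re (d 0 i).
pose t := sort (relpre f <=%R) (enum 'I_n).
have spE : spectrum A = map f t.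
  by rewrite (@spectrum_diag _ _ _ _ Pu AE) sort_map.
have st : size t = n by rewrite size_sort size_enum_ord.
have tu : uniq t by rewrite sort_uniq enum_uniq.
(* [t] lists the indices by increasing eigenvalue, so [g] is the sorting permutation. The default is
   [k] itself because ['I_n] may be empty; [gnth] changes it. *)
pose g (k : 'I_n) := nth k t k.
have gnth (k k0 : 'I_n) : g k = nth k0 t k.
  by rewrite /g; apply: set_nth_default; rewrite st.
have ginj : injective g.
  move=> j k; rewrite (gnth j j) (gnth k j) => /eqP.
  by rewrite nth_uniq ?st// => /eqP /val_inj.
have spg (k : 'I_n) : ((spectrum A)`_k)%:C = d 0 (g k).
  rewrite spE (nth_map k) ?st// -/(g k) /f RRe_real//.
  by move/mxOverP : Dr; apply.
have dotu i v : dot ((row i P)^t*) v = (P *m v) i 0.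
  by rewrite /dot trmxCK -row_mul mxE.
have dotP v w : dot v w = \sum_i Num.conj ((P *m v) i 0) * (P *m w) i 0.
  rewrite -dotE /dot; congr (fun_of_matrix _ 0 0).
  by rewrite trmx_mul map_mxM/= mulmxA -[_ *m P^t* *m P]mulmxA PP' mulmx1.
have PA v : P *m (A *m v) = diag_mx d *m (P *m v).
  by rewrite {1}AE -!mulmxA mulKVmx.
have Pcol i : P *m (row i P)^t* = delta_mx i 0.
  apply/matrixP => j k; rewrite !mxE ord1 eqxx andbT.
  have /matrixP/(_ j i) := PP; rewrite !mxE => <-.
  by apply: eq_bigr => l _; rewrite !mxE.
have diagE (w : 'cV_n) i : (diag_mx d *m w) i 0 = d 0 i * w i 0.
  by rewrite mul_diag_mx mxE.
have reidx (h : 'I_n -> R[i]) : \sum_i h i = \sum_k h (g k).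
  by rewrite (reindex_inj ginj).
exists (fun k => (row (g k) P)^t*); split.
- move=> j k; rewrite dotu Pcol mxE eqxx andbT.
  by rewrite (inj_eq ginj).
- move=> k; rewrite spg; apply: (can_inj (mulKmx Pu)).
  rewrite PA -scalemxAr Pcol; apply/matrixP => i j; rewrite ord1 diagE !mxE eqxx andbT.
  by case: eqP => [->//|_]; rewrite !mulr0.
- move=> v; rewrite dotP reidx; apply: eq_bigr => k _.
  by rewrite dotu normCKC.
- move=> v; rewrite dotP reidx; apply: eq_bigr => k _.
  by rewrite dotu normCKC PA spg diagE mulrCA.
Qed.

Lemma dotDr n (u v w : 'cV[R[i]]_n) : dot u (v + w) = dot u v + dot u w.
Proof. by rewrite /dot mulmxDr mxE. Qed.

Lemma dotZr n a (u v : 'cV[R[i]]_n) : dot u (a *: v) = a * dot u v.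
Proof. by rewrite /dot -scalemxAr mxE. Qed.

Lemma dotC n (u v : 'cV[R[i]]_n) : dot u v = Num.conj (dot v u).
Proof.
rewrite !dotE rmorph_sum; apply: eq_bigr => i _.
by rewrite rmorphM /= conjCK mulrC.
Qed.

Lemma dotDl n (u v w : 'cV[R[i]]_n) : dot (u + v) w = dot u w + dot v w.
Proof. by rewrite dotC dotDr rmorphD/= -!dotC. Qed.

Lemma dotZl n a (u v : 'cV[R[i]]_n) : dot (a *: u) v = Num.conj a * dot u v.
Proof. by rewrite dotC dotZr rmorphM/= -dotC. Qed.

Lemma dot_norm n (v : 'cV[R[i]]_n) : dot v v = \sum_i `|v i 0| ^+ 2.
Proof. by rewrite dotE; apply: eq_bigr => i _; rewrite normCKC. Qed.

Lemma dot_ge0 n (v : 'cV[R[i]]_n) : 0 <= dot v v.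
Proof. by rewrite dot_norm; apply: sumr_ge0 => i _; rewrite exprn_ge0. Qed.

Lemma dot_eq0 n (v : 'cV[R[i]]_n) : (dot v v == 0) = (v == 0).
Proof.
apply/eqP/eqP => [|->]; last by rewrite /dot mulmx0 mxE.
rewrite dot_norm => /psumr_eq0P-/(_ (fun i _ => exprn_ge0 2 (normr_ge0 _))) v0.
apply/matrixP => i j; rewrite ord1 mxE; apply/eqP.
by have /eqP := v0 i isT; rewrite expf_eq0 normr_eq0.
Qed.

Lemma dot_gt0 n (v : 'cV[R[i]]_n) : v != 0 -> 0 < dot v v.
Proof. by move=> v0; rewrite lt_def dot_eq0 v0 dot_ge0. Qed.

Lemma dot_selfadjoint n (A : 'M[R[i]]_n) u v :
  A^t* = A -> dot u (A *m v) = dot (A *m u) v.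
Proof. by move=> Ah; rewrite /dot trmx_mul map_mxM/= Ah mulmxA. Qed.

(** The sum of the moduli of the entries is a crude but sufficient constant: each [|v_i| |v_j|] is
    at most the larger of the two squares, hence at most [dot v v]. *)
Lemma dot_bounded n (B : 'M[R[i]]_n) : exists2 K : R,
  0 <= K & forall v, `|dot v (B *m v)| <= K%:C * dot v v.
Proof.
pose S : R[i] := \sum_i \sum_j `|B i j|.
have S0 : 0 <= S by apply: sumr_ge0 => i _; apply: sumr_ge0.
have SE : (complex.Re S)%:C = S by rewrite RRe_real// ger0_real.
exists (complex.Re S); first by rewrite -lecR SE.
move=> v; rewrite SE mulr_suml dotE.
apply: (le_trans (ler_norm_sum _ _ _)); apply: ler_sum => i _.
rewrite mxE mulr_sumr mulr_suml.
apply: (le_trans (ler_norm_sum _ _ _)); apply: ler_sum => j _.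
rewrite !normrM norm_conjC mulrCA ler_wpM2l//.
have vle k : `|v k 0| ^+ 2 <= dot v v.
  by rewrite dot_norm (bigD1 k)//= lerDl sumr_ge0// => l _; rewrite exprn_ge0.
have [ij|/ltW ji] := real_leP (normr_real (v i 0)) (normr_real (v j 0)).
  by apply: le_trans (vle j); rewrite expr2 ler_wpM2r.
by apply: le_trans (vle i); rewrite expr2 ler_wpM2l.
Qed.

Lemma ground_state n (A : 'M[R[i]]_n) : A^t* = A -> (0 < n)%N ->
  exists u : 'cV[R[i]]_n, [/\ u != 0, A *m u = ((spectrum A)`_0)%:C *: u
    & forall v, ((spectrum A)`_0)%:C * dot v v <= dot v (A *m v)].
Proof.
move=> Ah n0; have [u [uo uA uv uAv]] := spectrum_eigenbasis Ah.
exists (u (Ordinal n0)); split; last 1 first.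
- move=> v; rewrite uAv uv mulr_sumr ler_sum// => k _.
  rewrite ler_wpM2r ?exprn_ge0// lecR.
  exact: spectrum_nondecreasing.
- by rewrite -dot_eq0 uo eqxx oner_eq0.
- exact: uA.
Qed.

Lemma first_excited_state n (A : 'M[R[i]]_n) : A^t* = A -> (1 < n)%N ->
  exists u0 u1 : 'cV[R[i]]_n, [/\ u0 != 0 /\ A *m u0 = ((spectrum A)`_0)%:C *: u0,
      u1 != 0 /\ A *m u1 = ((spectrum A)`_1)%:C *: u1, dot u0 u1 = 0
    & forall v, dot u0 v = 0 -> ((spectrum A)`_1)%:C * dot v v <= dot v (A *m v)].
Proof.
move=> Ah n1; have [u [uo uA uv uAv]] := spectrum_eigenbasis Ah.
have n0 := ltnW n1.
exists (u (Ordinal n0)), (u (Ordinal n1)); split.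
- by split; [rewrite -dot_eq0 uo eqxx oner_eq0|exact: uA].
- by split; [rewrite -dot_eq0 uo eqxx oner_eq0|exact: uA].
- by rewrite uo.
- move=> v v0; rewrite uAv uv mulr_sumr ler_sum// => k _.
  have [->|k0] := eqVneq k (Ordinal n0); first by rewrite v0 normr0 expr0n !mulr0.
  rewrite ler_wpM2r ?exprn_ge0// lecR.
  apply: spectrum_nondecreasing => //=; rewrite lt0n; by apply: contraNneq k0 => k0; apply/eqP/val_inj.
Qed.

Lemma spectrum0_le n (A : 'M[R[i]]_n) (v : 'cV_n) c : A^t* = A -> v != 0 ->
  dot v (A *m v) <= c%:C * dot v v -> (spectrum A)`_0 <= c.
Proof.
move=> Ah v0 vA.
have n0 : (0 < n)%N.
  by case: n A v {Ah vA} v0 => // A v; rewrite (flatmx0 v) eqxx.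
have [u [_ _ /(_ v) /le_trans/(_ vA)]] := ground_state Ah n0.
by rewrite ler_pM2r ?dot_gt0// lecR.
Qed.

(* The combination of [w0] and [w1] orthogonal to the ground state is the test vector. *)
Lemma spectrum1_le n (A : 'M[R[i]]_n) (w0 w1 : 'cV_n) c : A^t* = A ->
    w0 != 0 -> w1 != 0 -> dot w0 w1 = 0 ->
    (forall a b, let v := a *: w0 + b *: w1 in
      dot v (A *m v) <= c%:C * dot v v) ->
  (1 < n)%N -> (spectrum A)`_1 <= c.
Proof.
move=> Ah w00 w10 w01 wc n1.
have [u0 [u1 [_ _ _ uv]]] := first_excited_state Ah n1.
have key a b : a *: w0 + b *: w1 != 0 -> dot u0 (a *: w0 + b *: w1) = 0 ->
    (spectrum A)`_1 <= c.
  move=> v0 /uv/le_trans/(_ (wc a b)).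
  by rewrite ler_pM2r ?dot_gt0// lecR.
have [u00|u00] := eqVneq (dot u0 w0) 0.
  by apply: (key 1 0); rewrite scale1r scale0r addr0.
apply: (key (dot u0 w1) (- dot u0 w0)); last first.
  by rewrite dotDr !dotZr mulNr mulrC subrr.
rewrite -dot_eq0 dotDr !dotZr !dotDl !dotZl w01 (dotC w1 w0) w01 rmorph0.
rewrite !mulr0 addr0 add0r !mulrA -!normCK gt_eqF//.
apply: ltr_wpDl; first by rewrite mulr_ge0 ?exprn_ge0 ?dot_ge0.
by rewrite mulr_gt0 ?dot_gt0// exprn_gt0// normr_gt0 oppr_eq0.
Qed.

(** Produces the bound on a plane that [spectrum1_le] requires: by orthogonality the form is a
    combination of the two eigenvalues with nonnegative weights. *)
Lemma eigenspan_form_le n (B : 'M[R[i]]_n) (w0 w1 : 'cV_n) (l0 l1 c : R) a b :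
    B *m w0 = l0%:C *: w0 -> B *m w1 = l1%:C *: w1 -> dot w0 w1 = 0 ->
    l0 <= c -> l1 <= c ->
  let v := a *: w0 + b *: w1 in dot v (B *m v) <= c%:C * dot v v.
Proof.
move=> B0 B1 w01 l0c l1c /=.
rewrite mulmxDr -!scalemxAr B0 B1 !scalerA.
rewrite !dotDr !dotZr !dotDl !dotZl w01 (dotC w1 w0) w01 rmorph0.
rewrite !mulr0 addr0 add0r mulrDr.
have E (l : R) (x w : R[i]) : x * l%:C * (Num.conj x * w) = l%:C * (`|x| ^+ 2 * w).
  by rewrite normCK; ring.
have F (x w : R[i]) : x * (Num.conj x * w) = `|x| ^+ 2 * w by rewrite normCK; ring.
rewrite !E !F; apply: lerD; apply: ler_wpM2r; rewrite ?lecR//;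
  by rewrite mulr_ge0 ?exprn_ge0 ?dot_ge0.
Qed.

Lemma eigen_orthogonal n (A : 'M[R[i]]_n) (u v : 'cV_n) (l k : R) : A^t* = A ->
  A *m u = l%:C *: u -> A *m v = k%:C *: v -> l != k -> dot u v = 0.
Proof.
move=> Ah Au Av lk; have := dot_selfadjoint u v Ah.
rewrite Au Av dotZr dotZl.
have -> : Num.conj (l%:C : R[i]) = l%:C by apply: conjc_real.
move/eqP; rewrite -subr_eq0 -mulrBl mulf_eq0 subr_eq0.
by case/orP => /eqP// /complexI kl; rewrite kl eqxx in lk.
Qed.

(** Weyl monotonicity for the two lowest levels: the low eigenvectors of [B] serve as trial vectors
    for [A]. *)
Lemma spectrum_le_add n (A B : 'M[R[i]]_n) (h : R) k : A^t* = A -> B^t* = B ->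
    (forall v, dot v (A *m v) <= dot v (B *m v) + h%:C * dot v v) ->
  (k < 2)%N -> (k < n)%N -> (spectrum A)`_k <= (spectrum B)`_k + h.
Proof.
move=> Ah Bh AB; case: k => [_ n0|[_ n1|//]].
  have [u [u0 uB _]] := ground_state Bh n0.
  apply: (@spectrum0_le _ _ u) => //; apply: (le_trans (AB u)).
  by rewrite uB dotZr rmorphD mulrDl.
have [u0 [u1 [[u00 uB0] [u10 uB1] u01 _]]] := first_excited_state Bh n1.
apply: (@spectrum1_le _ _ u0 u1) => // a b; apply: (le_trans (AB _)).
rewrite [X in _ <= X * _]rmorphD mulrDl lerD2r.
apply: (eigenspan_form_le _ _ uB0 uB1) => //.
exact: spectrum_nondecreasing.
Qed.

Lemma gap_lipschitz n (A B : 'M[R[i]]_n) (h : R) : 0 <= h -> A^t* = A -> B^t* = B ->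
    (forall v, `|dot v ((A - B) *m v)| <= h%:C * dot v v) ->
  `|gap A - gap B| <= 2 * h.
Proof.
move=> h0 Ah Bh AB.
have dotB v : dot v ((A - B) *m v) = dot v (A *m v) - dot v (B *m v).
  by rewrite mulmxBl dotDr -scaleN1r dotZr mulN1r.
have real v : dot v ((A - B) *m v) \is Num.real.
  by apply/CrealP; rewrite -dotC -dot_selfadjoint// linearB map_mxB/= Ah Bh.
have le1 v : dot v (A *m v) <= dot v (B *m v) + h%:C * dot v v.
  by rewrite -lerBlDl -dotB; apply: le_trans (AB v); exact: real_ler_norm.
have le2 v : dot v (B *m v) <= dot v (A *m v) + h%:C * dot v v.
  rewrite -lerBlDl -opprB -dotB; apply: le_trans (AB v); rewrite -normrN.
  by apply: real_ler_norm; rewrite rpredN.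
have lAB k := @spectrum_le_add _ A B h k Ah Bh le1.
have lBA k := @spectrum_le_add _ B A h k Bh Ah le2.
have := size_spectrum B; have := size_spectrum A; rewrite /gap.
move: (spectrum A) (spectrum B) lAB lBA => p q lpq lqp sp sq.
(* The second alternative covers dimension at most [k], where both entries are the default 0. *)
have dist k : (k < 2)%N -> `|p`_k - q`_k| <= h \/ (n <= k)%N /\ p`_k = q`_k.
  move=> k2; case: (ltnP k n) => kn; last first.
    by right; rewrite !nth_default ?sp ?sq.
  by left; rewrite ler_distl lerBlDr lpq// lqp.
have := dist 0%N isT; have := dist 1%N isT; rewrite !ler_norml.
move=> [/andP[p1 p2]|[n1 e1]] [/andP[p3 p4]|[n0 e0]]; apply/andP; split; lra.
Qed.

End Spectral.

(** * The secular equation of a rank-one perturbation *)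

Section RankOnePerturbation.
Variables (R : realType) (n : nat) (E : 'I_n -> R).
Implicit Types (s z : R) (v : 'cV[R[i]]_n).
Local Open Scope complex_scope.
Local Open Scope sesquilinear_scope.

Let rcM (x y : R) : (x * y)%:C = x%:C * y%:C. Proof. exact: rmorphM. Qed.
Let rcB (x y : R) : (x - y)%:C = x%:C - y%:C. Proof. exact: rmorphB. Qed.
Let rc1 : (1 : R)%:C = 1. Proof. by []. Qed.
Let rc_sum (f : 'I_n -> R) : (\sum_i f i)%:C = \sum_i (f i)%:C.
Proof. exact: rmorph_sum. Qed.

(* [(1 - s) (1 - |F><F|) + s diag E] with [F] the normalized all-ones vector. *)
Definition search_ham s : 'M[R[i]]_n := \matrix_(i, j)
  ((1 - s) * ((i == j)%:R - n%:R^-1) + s * E i * (i == j)%:R)%:C.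

(** The resolvent element [<F| (diag E - z)^-1 |F>] at the uniform vector. *)
Definition secular z : R := n%:R^-1 * \sum_i (E i - z)^-1.

Lemma search_ham_hermitian s : (search_ham s)^t* = search_ham s.
Proof.
apply/matrixP => i j; rewrite !mxE; rewrite [LHS]conjc_real.
by have [->|ij] := eqVneq i j; rewrite ?mulr0.
Qed.

Lemma search_hamE s v i : (search_ham s *m v) i 0 =
  (1 - s + s * E i)%:C * v i 0 - ((1 - s) / n%:R)%:C * \sum_j v j 0.
Proof.
rewrite mxE mulr_sumr.
transitivity (\sum_j (((1 - s + s * E i) * (i == j)%:R)%:C * v j 0 -
    ((1 - s) / n%:R)%:C * v j 0)).
  apply: eq_bigr => j _; rewrite mxE -mulrBl -rcB; congr (_%:C * _); ring.
rewrite sumrB; congr (_ - _).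
rewrite (bigD1 i)//= eqxx mulr1 big1 ?addr0// => j ji.
by rewrite eq_sym (negbTE ji) mulr0 mul0r.
Qed.

Lemma search_ham_affine s t :
  search_ham s - search_ham t = (s - t)%:C *: (search_ham 1 - search_ham 0).
Proof.
by apply/matrixP => i j; rewrite !mxE -!rcB -rcM; congr (_%:C); ring.
Qed.

Lemma gap_search_ham_lipschitz : exists2 K : R, 0 <= K
  & forall s t, `|gap (search_ham s) - gap (search_ham t)| <= K * `|s - t|.
Proof.
have [K K0 HK] := dot_bounded (search_ham 1 - search_ham 0).
exists (2 * K); first by rewrite mulr_ge0.
move=> s t; rewrite -mulrA.
apply: gap_lipschitz; [by rewrite mulr_ge0|exact: search_ham_hermitian..|move=> v].
rewrite search_ham_affine -scalemxAl dotZr normrM mulrC rcM mulrAC.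
apply: ler_pM => //.
by rewrite normc_def/= expr0n/= addr0 sqrtr_sqr.
Qed.

Hypothesis n_gt0 : (0 < n)%N.

(** The projector contributes the same amount to every coordinate, so with the eigenvalue written as
    [1 - s + s * z] the right side does not depend on [i]. *)
Lemma eigen_eq s z v i : search_ham s *m v = (1 - s + s * z)%:C *: v ->
  (s * (E i - z))%:C * v i 0 = ((1 - s) / n%:R)%:C * \sum_j v j 0.
Proof.
move/matrixP/(_ i 0); rewrite search_hamE mxE => h.
apply: (@subrI _ ((1 - s + s * E i)%:C * v i 0)); rewrite h -mulrBl -rcB.
by congr (_%:C * _); ring.
Qed.

(** Dividing [eigen_eq] by [s (E_i - z)] determines the eigenvector up to a scalar; summing its
    coordinates and cancelling their nonzero sum leaves the secular equation. *)
Lemma eigenvector_secular s z v : 0 < s < 1 -> (forall i, E i != z) ->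
    v != 0 -> search_ham s *m v = (1 - s + s * z)%:C *: v ->
  secular z = s / (1 - s) /\
  exists2 c, c != 0 & forall i, v i 0 = c * ((E i - z)^-1)%:C.
Proof.
move=> /andP[s0 s1] Ez v0 Hv.
have nR : n%:R != 0 :> R by rewrite pnatr_eq0 -lt0n.
have s'0 : 1 - s != 0 by rewrite subr_eq0 gt_eqF.
pose S := \sum_j v j 0.
pose c := ((1 - s) / (n%:R * s))%:C * S.
have vE i : v i 0 = c * ((E i - z)^-1)%:C.
  have Ezi : E i - z != 0 by rewrite subr_eq0.
  have -> : v i 0 = ((s * (E i - z))^-1)%:C * ((s * (E i - z))%:C * v i 0).
    by rewrite mulrA -rcM mulVf ?mul1r// mulf_neq0// gt_eqF.
  rewrite (eigen_eq i Hv) /c -/S mulrA [RHS]mulrAC -!rcM; congr (_%:C * _).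
  by field; rewrite Ezi nR gt_eqF.
have c0 : c != 0.
  apply: contra_neq v0 => c0; apply/matrixP => i j.
  by rewrite ord1 vE c0 mul0r mxE.
split; last by exists c.
have S0 : S != 0 by apply: contra_neq c0 => S0; rewrite /c S0 mulr0.
have : S = c * (n%:R * secular z)%:C.
  rewrite {1}/S (eq_bigr _ (fun i _ => vE i)) -mulr_sumr -rc_sum.
  by rewrite /secular mulrA divff// mul1r.
rewrite /c mulrAC -rcM -[X in X = _]mul1r => /(mulIf S0).
rewrite -[1%R]rc1 => /complexI h.
have -> : secular z = ((1 - s) / (n%:R * s) * (n%:R * secular z)) * (s / (1 - s)).
  by field; rewrite nR s'0 gt_eqF.
by rewrite -h mul1r.
Qed.

Lemma secular_eigenvector s z : 0 < s < 1 -> (forall i, E i != z) ->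
    secular z = s / (1 - s) ->
  exists2 v : 'cV[R[i]]_n, v != 0 & search_ham s *m v = (1 - s + s * z)%:C *: v.
Proof.
move=> /andP[s0 s1] Ez sz.
have nR : n%:R != 0 :> R by rewrite pnatr_eq0 -lt0n.
have s'0 : 1 - s != 0 by rewrite subr_eq0 gt_eqF.
exists (\col_i ((E i - z)^-1)%:C).
  apply/eqP => /matrixP/(_ (Ordinal n_gt0) 0); rewrite !mxE => /complexI/eqP.
  by rewrite invr_eq0 subr_eq0 (negbTE (Ez _)).
apply/matrixP => i j; rewrite ord1 search_hamE !mxE.
under eq_bigr do rewrite mxE.
rewrite -rc_sum -!rcM -rcB; congr (_%:C).
have -> : \sum_i (E i - z)^-1 = n%:R * (s / (1 - s)).
  by rewrite -sz /secular mulrA divff ?mul1r.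
have Ezi : E i - z != 0 by rewrite subr_eq0.
by field; rewrite Ezi nR s'0.
Qed.

End RankOnePerturbation.

(** * Estimates for the roots of the secular equation on both sides of the pole at 0 *)

Section SecularEquation.
Variables (R : realType) (n : nat) (E : 'I_n -> R) (i0 : 'I_n).
Hypothesis E0 : E i0 = 0.
Hypothesis E_ge1 : forall i, i != i0 -> 1 <= E i.
Implicit Types (s z a b : R).

Let S k : R := \sum_(i | i != i0) E i ^- k.
Let phi := secular E.

Let nR : 0 < n%:R :> R.
Proof. by rewrite ltr0n (leq_trans _ (ltn_ord i0)). Qed.

Lemma secular_split z :
  phi z = n%:R^-1 * (- z^-1 + \sum_(i | i != i0) (E i - z)^-1).
Proof. by rewrite /phi /secular (bigD1 i0)//= E0 sub0r invrN. Qed.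

Let sum_opp a :
  \sum_(i | i != i0) (E i - - a)^-1 = \sum_(i | i != i0) (E i + a)^-1.
Proof. by apply: eq_bigr => i _; rewrite opprK. Qed.

Let S1E : S 1 = \sum_(i | i != i0) (E i)^-1.
Proof. by apply: eq_bigr => i _; rewrite expr1. Qed.

(** [phi] is strictly increasing left of its first pole, which leaves room for only one negative
    root. *)
Lemma secular_neg_inj a b : a < 0 -> b < 0 -> phi a = phi b -> a = b.
Proof.
have mono x y : x < y -> y < 0 -> phi x < phi y.
  move=> xy y0; rewrite !secular_split ltr_pM2l ?invr_gt0//.
  have y1 : - x^-1 < - y^-1.
    by rewrite ltrN2 ltf_nV2 ?negrE// (lt_trans xy).
  apply: ltr_leD => //; apply: ler_sum => i /E_ge1 Ei.
  by rewrite lef_pV2 ?posrE; lra.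
move=> a0 b0 ab; apply/eqP; rewrite eq_le !leNgt; apply/andP; split; apply/negP.
  by move=> /mono/(_ a0); rewrite ab ltxx.
by move=> /mono/(_ b0); rewrite ab ltxx.
Qed.

(** The pole term is positive, and [E_i + a <= E_i (1 + a)] since [E_i >= 1]. At an actual level
    this bounds [s] from below. *)
Lemma secular_neg_ge a : 0 < a -> S 1 / n%:R / (1 + a) <= phi (- a).
Proof.
move=> a0; rewrite secular_split invrN opprK mulrAC mulrC ler_pM2l ?invr_gt0//.
apply: ler_wpDl; first by rewrite invr_ge0 ltW.
rewrite mulr_suml; apply: ler_sum => i /E_ge1 Ei.
by rewrite expr1 -invfM lef_pV2 ?posrE; nra.
Qed.

(** Equating the two values gives [1/a + 1/b = sum (a + b) / ((E_i - b) (E_i + a))]. Each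
    denominator is at least [(1 - b) E_i^2], the difference being [b E_i (E_i - 1) + a (E_i - b)];
    then [a + b] cancels. *)
Lemma secular_pair a b : 0 < a -> 0 < b < 1 -> phi (- a) = phi b ->
  1 - b <= a * b * S 2.
Proof.
move=> a0 /andP[b0 b1]; rewrite !secular_split.
have /mulfI h : n%:R^-1 != 0 :> R by rewrite invr_eq0 gt_eqF.
move/h => {h}; rewrite invrN opprK => eq.
have {}eq : a^-1 + b^-1 =
    \sum_(i | i != i0) ((E i - b)^-1 - (E i + a)^-1).
  by move: eq; rewrite sumrB sum_opp; lra.
have : a^-1 + b^-1 <= (a + b) / (1 - b) * S 2.
  rewrite eq /S mulr_sumr; apply: ler_sum => i /E_ge1 Ei.
  have -> : (E i - b)^-1 - (E i + a)^-1 = (a + b) / ((E i - b) * (E i + a)).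
    by field; rewrite !gt_eqF//; lra.
  rewrite -mulrA -invfM ler_pM2l; last lra.
  have p1 : 0 <= b * (E i * (E i - 1)) by rewrite !mulr_ge0//; lra.
  have p2 : 0 <= a * (E i - b) by rewrite mulr_ge0//; lra.
  rewrite lef_pV2 ?posrE; [lra| |].
    by rewrite mulr_gt0//; lra.
  by rewrite mulr_gt0 ?exprn_gt0//; lra.
have -> : a^-1 + b^-1 = (a + b) / (a * b) by field; rewrite !gt_eqF.
have ab : 0 < a + b by lra.
rewrite -mulrA ler_pM2l// [X in _ <= X]mulrC ler_pdivlMr; last lra.
by rewrite mulrC ler_pdivrMr ?mulr_gt0// [X in _ <= X]mulrC.
Qed.

(** [S 1 / n] is the first inverse moment, the value of [s / (1 - s)] at the crossing. The equation
    becomes [1/a = sum a / (E_i (E_i + a))], and [E_i + a <= (1 + a) E_i]. *)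
Lemma secular_neg_crossing a : 0 < a -> phi (- a) = S 1 / n%:R ->
  a ^+ 2 * S 2 <= 1 + a.
Proof.
move=> a0; rewrite secular_split mulrC => /divIf h.
have {}h : - (- a)^-1 + \sum_(i | i != i0) (E i - - a)^-1 = S 1.
  by apply: h; rewrite gt_eqF.
have {}h : a^-1 = \sum_(i | i != i0) ((E i)^-1 - (E i + a)^-1).
  rewrite sumrB; move: h; rewrite invrN opprK.
  by rewrite sum_opp S1E => <-; rewrite addrK.
have : a / (1 + a) * S 2 <= a^-1.
  rewrite h /S mulr_sumr; apply: ler_sum => i /E_ge1 Ei.
  have -> : (E i)^-1 - (E i + a)^-1 = a / (E i * (E i + a)).
    by field; rewrite !gt_eqF//; lra.
  have p : 0 <= a * (E i * (E i - 1)) by rewrite !mulr_ge0//; lra.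
  rewrite -mulrA -invfM ler_pM2l// lef_pV2 ?posrE; first lra.
    by rewrite mulr_gt0 ?exprn_gt0//; lra.
  by rewrite mulr_gt0//; lra.
rewrite -[X in _ <= X]mul1r ler_pdivlMr//.
have -> : a / (1 + a) * S 2 * a = a ^+ 2 * S 2 / (1 + a) by ring.
rewrite ler_pdivrMr; last lra.
by rewrite mul1r.
Qed.

(* Up to the factor [n], [phi z] minus the crossing value is [- z^-1 + z * sum];
   the linear term dominates the pole at [z = e], the pole at [z = e / 2]. *)
Lemma secular_pos_crossing e : 0 < e -> e <= 1 / 4 -> e ^+ 2 * S 2 = 1 ->
  exists2 b, 0 < b <= e & phi b = S 1 / n%:R.
Proof.
move=> e0 e1 eS.
have S2 : 0 < S 2.
  have : e ^+ 2 * S 2 > 0 by rewrite eS.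
  by rewrite pmulr_rgt0// exprn_gt0.
have phiB z : 0 < z < 1 -> n%:R * phi z - S 1 =
    - z^-1 + z * \sum_(i | i != i0) (E i * (E i - z))^-1.
  move=> /andP[z0 z1]; rewrite secular_split mulrA divff ?gt_eqF// mul1r.
  rewrite -addrA /S -sumrB mulr_sumr; congr (_ + _).
  apply: eq_bigr => i /E_ge1 Ei.
  by field; rewrite !gt_eqF//; lra.
have eI : e^-1 = e * S 2.
  by apply: (mulfI (lt0r_neq0 e0)); rewrite divff ?gt_eqF// mulrA -expr2 eS.
have up : S 1 / n%:R <= phi e.
  rewrite ler_pdivrMr// mulrC -subr_ge0 phiB; last lra.
  have : e * S 2 <= e * \sum_(i | i != i0) (E i * (E i - e))^-1.
    rewrite ler_pM2l//; apply: ler_sum => i /E_ge1 Ei.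
    rewrite lef_pV2 ?posrE ?exprn_gt0//; [nra|lra|].
    by rewrite mulr_gt0//; lra.
  by rewrite -eI; lra.
have lo : phi (e / 2) <= S 1 / n%:R.
  rewrite ler_pdivlMr// mulrC -subr_le0 phiB; last lra.
  have : e / 2 * (\sum_(i | i != i0) (E i * (E i - e / 2))^-1) <= e / 2 * (2 * S 2).
    rewrite ler_pM2l; last lra.
    rewrite /S mulr_sumr; apply: ler_sum => i /E_ge1 Ei.
    rewrite -[2]invrK -invfM lef_pV2 ?posrE; [nra|nra|nra].
  have -> : e / 2 * (2 * S 2) = e^-1 by rewrite eI; field.
  have -> : (e / 2)^-1 = 2 * e^-1 by field; rewrite gt_eqF.
  have : 0 < e^-1 by rewrite invr_gt0.
  lra.
have cont : {within `[e / 2, e], continuous phi}.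
  apply: continuous_in_subspaceT => x; rewrite inE/= in_itv/= => /andP[x0 x1].
  apply: cvgM; first exact: cvg_cst.
  apply: cvg_big => [|i _]; first exact: add_continuous.
  apply: cvgV.
    have [->|/E_ge1] := eqVneq i i0; last by rewrite subr_eq0 => Ei; rewrite gt_eqF//; lra.
    by rewrite E0 sub0r oppr_eq0 gt_eqF//; lra.
  by apply: cvgB; [exact: cvg_cst|exact: cvg_id].
have e2e : e / 2 <= e by lra.
have vb : Num.min (phi (e / 2)) (phi e) <= S 1 / n%:R
    <= Num.max (phi (e / 2)) (phi e).
  by rewrite ge_min le_max lo up orbT.
have [b] := IVT e2e cont vb; rewrite in_itv/= => /andP[b0 b1] pb; exists b => //.
by rewrite b1 andbT; lra.
Qed.

End SecularEquation.

(** * Bounds on the minimum gap *)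

Section SearchGap.
Variables (R : realType) (n : nat) (E : 'I_n -> R) (i0 : 'I_n).
Hypothesis E0 : E i0 = 0.
Hypothesis E_ge1 : forall i, i != i0 -> 1 <= E i.
Hypothesis n_gt1 : (1 < n)%N.
Implicit Types (s z a b : R).
Local Open Scope complex_scope.
Local Notation H := (search_ham E).
Local Notation sp s := (spectrum (H s)).

Let n_gt0 : (0 < n)%N := ltnW n_gt1.

Let neg_pole z : z < 0 -> forall i, E i != z.
Proof.
move=> z0 i; rewrite gt_eqF//; have [->|/E_ge1] := eqVneq i i0; last by lra.
by rewrite E0.
Qed.

Let pos_pole z : 0 < z < 1 -> forall i, E i != z.
Proof.
move=> z01 i; have [->|/E_ge1 Ei] := eqVneq i i0; first by rewrite E0 lt_eqF//; lra.
by rewrite gt_eqF//; lra.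
Qed.

(** The zero-cost basis vector is a trial vector of energy [(1 - s) (1 - 1/n)]. *)
Lemma spectrum0_lt s : s < 1 -> (sp s)`_0 < 1 - s.
Proof.
move=> s1; apply: (@le_lt_trans _ _ ((1 - s) * (1 - n%:R^-1))); last first.
  by rewrite gtr_pMr ?subr_gt0// ltrBlDr ltrDl invr_gt0 ltr0n.
have e_i0 : (delta_mx i0 0 : 'cV[R[i]]_n) != 0.
  by apply/eqP => /matrixP/(_ i0 0)/eqP; rewrite !mxE !eqxx/= oner_eq0.
apply: (spectrum0_le (search_ham_hermitian E s) e_i0).
have dot_i0 (v : 'cV[R[i]]_n) : dot (delta_mx i0 0) v = v i0 0.
  rewrite dotE (bigD1 i0)//= mxE !eqxx rmorph1 mul1r big1 ?addr0// => i ii0.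
  by rewrite mxE (negbTE ii0) rmorph0 mul0r.
rewrite !dot_i0 search_hamE E0 mulr0 addr0 [delta_mx _ _ _ _]mxE !eqxx !mulr1.
rewrite (bigD1 i0)//= big1 => [|i ii0]; last by rewrite mxE (negbTE ii0).
by rewrite mxE !eqxx addr0 mulr1 -rmorphB lecR; lra.
Qed.

(** The secular equation is silent at the pole [z = 0]. Coordinate [i0] of [eigen_eq] forces the
    coordinate sum to vanish, then all coordinates with [E_i >= 1] vanish, and the sum removes the
    last one. *)
Lemma zero_not_eigenvalue s (v : 'cV[R[i]]_n) : 0 < s < 1 ->
  H s *m v = (1 - s + s * 0)%:C *: v -> v = 0.
Proof.
move=> /andP[s0 s1] Hv.
have nR : n%:R != 0 :> R by rewrite pnatr_eq0 -lt0n.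
have cne (x : R) : x != 0 -> x%:C != 0 :> R[i].
  by apply: contra_neq => /complexI.
have S0 : \sum_j v j 0 = 0.
  have := eigen_eq i0 Hv; rewrite E0 subr0 mulr0 mul0r => /esym/eqP.
  rewrite mulf_eq0 => /orP[|/eqP//]; rewrite (negbTE (cne _ _))//.
  by rewrite mulf_neq0 ?invr_eq0// subr_eq0 gt_eqF.
have v0 i : i != i0 -> v i 0 = 0.
  move=> /E_ge1 Ei; have := eigen_eq i Hv; rewrite S0 mulr0 subr0 => /eqP.
  rewrite mulf_eq0 => /orP[|/eqP//]; rewrite (negbTE (cne _ _))//.
  by rewrite mulf_neq0// gt_eqF//; lra.
apply/matrixP => i j; rewrite ord1 mxE.
have [->|/v0//] := eqVneq i i0.
by move: S0; rewrite (bigD1 i0)//= big1 ?addr0// => k /v0.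
Qed.

(** The pole at 0 separates the two lowest levels. The condition [b < 1] keeps [b] clear of the
    positive costs, where the secular equation could fail. *)
Lemma low_spectrum s : 0 < s < 1 -> exists a b,
  [/\ 0 < a /\ 0 < b, (sp s)`_0 = 1 - s - s * a, (sp s)`_1 = 1 - s + s * b,
      secular E (- a) = s / (1 - s) & b < 1 -> secular E b = s / (1 - s)].
Proof.
move=> s01; have /andP[s0 s1] := s01.
have [u0 [u1 [[u00 uA0] [u10 uA1] u01 _]]] :=
  first_excited_state (search_ham_hermitian E s) n_gt1.
have param (l : R) : l = 1 - s + s * ((l - (1 - s)) / s).
  by rewrite mulrC divfK ?gt_eqF// addrC subrK.
have l0 := spectrum0_lt s1.
move: (sp s)`_0 (sp s)`_1 uA0 uA1 l0 => l0 l1 uA0 uA1 l0lt.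
move: uA0 uA1; rewrite (param l0) (param l1).
have : (l0 - (1 - s)) / s < 0 by rewrite pmulr_llt0 ?invr_gt0// subr_lt0.
move: ((l0 - _) / s) ((l1 - _) / s) => {param l0lt} {}l0 {}l1 l0lt uA0 uA1.
have [sec0 [c0 c00 u0E]] := eigenvector_secular n_gt0 s01 (neg_pole l0lt) u00 uA0.
exists (- l0), l1; rewrite opprK mulrN opprK oppr_gt0.
have sec1 : l1 != 0 -> l1 < 1 -> secular E l1 = s / (1 - s) /\
    exists2 c, c != 0 & forall i, u1 i 0 = c * ((E i - l1)^-1)%:C.
  move=> l10 l11; apply: (eigenvector_secular n_gt0 s01) => //.
  by have [/neg_pole//|] := ltP l1 0; rewrite le_eqVlt eq_sym (negbTE l10)/= => l1p;
    apply: pos_pole; rewrite l1p.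
have l1p : 0 < l1.
  rewrite lt_neqAle eq_sym; have [l1z|l1z]/= := eqVneq l1 0.
    by move: uA1; rewrite l1z => /(zero_not_eigenvalue s01)/eqP; rewrite (negbTE u10).
  (* A negative [l1] would coincide with [l0] and make the two eigenvectors proportional, against
     their orthogonality. *)
  rewrite leNgt; apply/negP => l1n.
  have [sec [c1 c10 u1E]] := sec1 l1z (lt_trans l1n ltr01).
  have l01 : l0 = l1.
    by apply: (secular_neg_inj E0 E_ge1) => //; rewrite sec0 sec.
  have : u1 = (c1 / c0) *: u0.
    apply/matrixP => i j; rewrite ord1 mxE u0E u1E l01 mulrA divfK//.
  move=> u1Z; move: u01; rewrite u1Z dotZr => /eqP.
  by rewrite mulf_eq0 dot_eq0 (negbTE u00) orbF mulf_eq0 invr_eq0 (negbTE c10) (negbTE c00).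
split=> //.
by move=> /(sec1 (lt0r_neq0 l1p))[].
Qed.

End SearchGap.

(** * Continuity of the gap in [s] and existence of a minimizer *)

Lemma min_gap_attained (R : realType) n (E : 'I_n -> R) :
  exists2 s : R, 0 <= s <= 1 & gap (search_ham E s) = min_gap (search_ham E) /\
    forall t, 0 <= t <= 1 -> gap (search_ham E s) <= gap (search_ham E t).
Proof.
have [K K0 lip] := gap_search_ham_lipschitz E.
have cont : {within `[0, 1], continuous (fun s => gap (search_ham E s))}.
  apply: continuous_subspaceT => s; apply/cvgrPdist_le => /= e e0.
  (* [K] may be 0, hence the division by [K + 1]. *)
  have K1 : 0 < K + 1 by rewrite ltr_wpDl.
  have eK : 0 < e / (K + 1) by rewrite divr_gt0.
  have /cvgrPdist_le/(_ _ eK) near_s := @cvg_id _ (nbhs (s : R)).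
  near=> t; apply: (le_trans (lip _ _)).
  have st : `|s - t| <= e / (K + 1) by near: t; exact: near_s.
  apply: (@le_trans _ _ ((K + 1) * `|s - t|)).
    by rewrite ler_wpM2r// lerDl.
  by rewrite mulrC -ler_pdivlMr.
have [c] := EVT_min ler01 cont; rewrite in_itv/= => c01 cmin; exists c => //.
have cmin' t : 0 <= t <= 1 -> gap (search_ham E c) <= gap (search_ham E t).
  by move=> t01; apply: cmin; rewrite in_itv.
split=> //; apply/eqP; rewrite eq_le; apply/andP; split.
  apply: lb_le_inf; first by exists (gap (search_ham E c)), c => //=; rewrite in_itv.
  by move=> y [t /=]; rewrite in_itv/= => t01 <-; exact: cmin'.
apply: inf_lbound; last by exists c => //=; rewrite in_itv.
by exists (gap (search_ham E c)) => y [t /=]; rewrite in_itv/= => t01 <-; exact: cmin'.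
Unshelve. all: by end_near. Qed.

(** * Two-sided estimates around the avoided crossing *)

Section SearchGapBounds.
Variables (R : realType) (n : nat) (E : 'I_n -> R) (i0 : 'I_n).
Hypothesis E0 : E i0 = 0.
Hypothesis E_ge1 : forall i, i != i0 -> 1 <= E i.
Hypothesis n_gt1 : (1 < n)%N.
Implicit Types (s e : R).
Local Notation H := (search_ham E).

Let A k : R := n%:R^-1 * \sum_(i | i != i0) E i ^- k.

Let nR : 0 < n%:R :> R. Proof. by rewrite ltr0n ltnW. Qed.

Let A1E : A 1 = (\sum_(i | i != i0) E i ^- 1) / n%:R.
Proof. by rewrite mulrC. Qed.

Let A1_gt0 : 0 < A 1.
Proof.
rewrite mulr_gt0 ?invr_gt0//.
have [i1 i10] : exists i1, i1 != i0.
  have : (0 < #|[pred i | i != i0]|)%N.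
    have := cardC1 i0; rewrite card_ord => h; rewrite (eq_card (B := predC1 i0))//.
    by rewrite h -ltnS prednK // ltnW.
  by case/card_gt0P => i1; exists i1.
rewrite (bigD1 i1)//= ltr_pwDl//.
  by rewrite expr1 invr_gt0; have := E_ge1 i10; lra.
by apply: sumr_ge0 => i /andP[/E_ge1 Ei _]; rewrite expr1 invr_ge0; lra.
Qed.

(** [eE] states [e = 1 / sqrt (n * A 2)] without a square root; [e] is the scale of the two lowest
    levels at the crossing. *)
Variable e : R.
Hypothesis e_gt0 : 0 < e.
Hypothesis e_le : e <= 1 / 4.
Hypothesis eE : e ^+ 2 * (n%:R * A 2) = 1.

Let eS : e ^+ 2 * \sum_(i | i != i0) E i ^- 2 = 1.
Proof. by rewrite -eE /A mulVKf ?gt_eqF. Qed.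

Lemma gap_lower s : 0 < s < 1 ->
  2 * A 1 / (1 + A 1) * e * ((1 - 2 * e) / (1 + 4 * e)) <= gap (H s).
Proof.
move=> s01; have /andP[s0 s1] := s01; have e0 := e_gt0; have e4 := e_le.
have [a [b [[a0 b0] g0 g1 sa sb]]] := low_spectrum E0 E_ge1 n_gt1 s01.
have -> : gap (H s) = s * (a + b) by rewrite /gap g0 g1; lra.
have sge : A 1 / (1 + A 1 + a) <= s.
  have := secular_neg_ge E0 E_ge1 a0; rewrite sa -A1E.
  rewrite ler_pdivrMr; last lra.
  rewrite mulrAC ler_pdivlMr; last lra.
  have A0 := A1_gt0; rewrite ler_pdivrMr; lra.
have A0 := A1_gt0; have sa0 := sa; move: (A 1) A0 sge => B B0 sge {s0 s1 s01 g0 g1 sa}.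
have Be : 0 < 1 + B by lra.
have loss : (1 - 2 * e) / (1 + 4 * e) <= 1 by rewrite ler_pdivrMr; lra.
have loss0 : 0 <= (1 - 2 * e) / (1 + 4 * e) by rewrite divr_ge0//; lra.
have T0 : 0 <= 2 * B / (1 + B) * e by rewrite !mulr_ge0 ?invr_ge0//; lra.
(* When [a >= 4 e] the part [s a] of the gap already suffices; otherwise [s] is bounded below by
   nearly its crossing value. *)
have [ae|ae] := leP (4 * e) a.
  apply: (le_trans (ler_piMr T0 loss)).
  apply: (@le_trans _ _ (B / (1 + B + a) * a)); last first.
    by apply: ler_pM => //; [rewrite divr_ge0//; lra|lra|lra].
  have -> : 2 * B / (1 + B) * e = B * (2 * e / (1 + B)) by ring.
  rewrite -[X in _ <= X]mulrA ler_pM2l// [X in _ <= X]mulrC ler_pdivlMr; last lra.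
  rewrite mulrAC ler_pdivrMr//.
  have : e * a <= 1 / 4 * a by rewrite ler_wpM2r//; lra.
  have : 4 * e * B <= a * B by rewrite ler_wpM2r//; lra.
  have : 0 <= a * B by rewrite mulr_ge0 ?ltW.
  lra.
have sge2 : B / ((1 + B) * (1 + 4 * e)) <= s.
  apply: le_trans sge; rewrite ler_pM2l// lef_pV2 ?posrE ?mulr_gt0//; try lra.
  have : 0 <= B * e by rewrite mulr_ge0//; lra.
  lra.
(* Immediate for [b >= 2 e]. Otherwise [secular_pair] gives [a b >= e^2 (1 - 2 e)], and
   [(a + b)^2 >= 4 a b] suffices because [1 - 2 e] lies in [(0, 1)]. *)
have sum_ge : 2 * e * (1 - 2 * e) <= a + b.
  have [be|be] := leP (2 * e) b.
    have : 0 <= e * e by rewrite mulr_ge0//; lra.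
    lra.
  have b1 : b < 1 by lra.
  have {}sb := secular_pair E0 E_ge1 a0 (introT andP (conj b0 b1)) (etrans sa0 (esym (sb b1))).
  have {}sb : e ^+ 2 * (1 - b) <= a * b.
    have := ler_wpM2l (exprn_ge0 2 (ltW e_gt0)) sb.
    by rewrite [X in _ <= X]mulrCA eS mulr1.
  rewrite leNgt; apply/negP => lt.
  have : (a + b) ^+ 2 < (2 * e * (1 - 2 * e)) ^+ 2.
    by rewrite ltr_sqr ?nnegrE ?mulr_ge0//; lra.
  have : 0 <= (a - b) ^+ 2 by rewrite sqr_ge0.
  have : e ^+ 2 * (1 - 2 * e) <= e ^+ 2 * (1 - b) by rewrite ler_pM2l ?exprn_gt0//; lra.
  have e3 : 0 < e * e * e by rewrite !mulr_gt0.
  nra.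
have -> : 2 * B / (1 + B) * e * ((1 - 2 * e) / (1 + 4 * e)) =
    B / ((1 + B) * (1 + 4 * e)) * (2 * e * (1 - 2 * e)).
  by field; rewrite !gt_eqF//; lra.
apply: ler_pM => //; first by rewrite divr_ge0 ?(ltW B0)// mulr_ge0//; lra.
by rewrite mulr_ge0//; lra.
Qed.

Lemma gap_upper : gap (H (A 1 / (1 + A 1))) <= 2 * A 1 / (1 + A 1) * e * (1 + e).
Proof.
have e0 := e_gt0; have e4 := e_le; have A0 := A1_gt0; set s := A 1 / (1 + A 1).
have s01 : 0 < s < 1.
  by rewrite divr_gt0 ?ltr_pdivrMr//=; lra.
have ss : s / (1 - s) = (\sum_(i | i != i0) E i ^- 1) / n%:R.
  rewrite -A1E /s; field; apply/andP; split; rewrite gt_eqF//; lra.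
have [a [b [[a0 b0] g0 g1 sa sb]]] := low_spectrum E0 E_ge1 n_gt1 s01.
have ae : a <= e * (1 + e).
  have h := secular_neg_crossing E0 E_ge1 a0 (etrans sa ss).
  have {}h : a ^+ 2 <= e ^+ 2 * (1 + a).
    have := ler_wpM2l (exprn_ge0 2 (ltW e_gt0)) h.
    by rewrite [X in X <= _]mulrCA eS mulr1.
  (* [h] amounts to [a (a - e^2) <= e^2], but the left side exceeds [e^2 (1 + e)] once
     [a > e (1 + e)]. *)
  rewrite leNgt; apply/negP => ae.
  have e3 : 0 < e * e * e by rewrite !mulr_gt0.
  have : e * (1 + e) * (a - e ^+ 2) < a * (a - e ^+ 2).
    rewrite ltr_pM2r//; nra.
  nra.
(* The root [z] in [(0, e]] found by the intermediate value theorem yields an eigenvector orthogonal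
   to the ground state, so the second level is at most that of [z]. *)
have be : b <= e.
  have [z /andP[z0 ze] sz] := secular_pos_crossing E0 E_ge1 e_gt0 e_le eS.
  have Hh := search_ham_hermitian E s.
  have zp i : E i != z.
    have [->|/E_ge1 Ei] := eqVneq i i0; first by rewrite E0 lt_eqF.
    by rewrite gt_eqF//; lra.
  have [w w0 Hw] := secular_eigenvector (ltnW n_gt1) s01 zp (etrans sz (esym ss)).
  have [u [u0 Hu _]] := ground_state Hh (ltnW n_gt1).
  have uw : dot u w = 0.
    apply: (eigen_orthogonal Hh Hu Hw); rewrite g0 lt_eqF//.
    have := mulr_gt0 (andP s01).1 a0; have := mulr_gt0 (andP s01).1 z0; lra.
  have : (spectrum (H s))`_1 <= 1 - s + s * z.
    apply: (spectrum1_le Hh u0 w0 uw) => //= c d.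
    apply: (eigenspan_form_le _ _ Hu Hw uw) => //; rewrite g0.
    have := mulr_gt0 (andP s01).1 a0; have := mulr_gt0 (andP s01).1 z0; lra.
  by rewrite g1 lerD2l ler_pM2l ?(andP s01).1// => /le_trans; exact.
have -> : gap (H s) = s * (a + b) by rewrite /gap g0 g1; lra.
have -> : 2 * A 1 / (1 + A 1) * e * (1 + e) = s * (2 * (e * (1 + e))).
  by rewrite /s; ring.
rewrite ler_pM2l; last lra.
have : 0 <= e * e by rewrite mulr_ge0//; lra.
lra.
Qed.

(** The minimizer may be an endpoint, where [gap_lower] does not apply. A shortfall [D > 0] there
    would persist, by Lipschitz continuity, at a nearby interior point. *)
Lemma min_gap_bounds :
  2 * A 1 / (1 + A 1) * e * ((1 - 2 * e) / (1 + 4 * e)) <= min_gap H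
    <= 2 * A 1 / (1 + A 1) * e * (1 + e).
Proof.
set T := 2 * A 1 / (1 + A 1) * e; have [c c01 [<- cmin]] := min_gap_attained E; apply/andP; split; last first.
  apply: le_trans gap_upper; apply: cmin; have A0 := A1_gt0.
  by rewrite divr_ge0 ?ler_pdivrMr//=; lra.
have e0 := e_gt0; have e4 := e_le; have [K K0 lip] := gap_search_ham_lipschitz E.
rewrite leNgt; apply/negP; rewrite -subr_gt0; set D := _ - gap _ => D0.
(* Chosen in [(0, 1)] with [K d < D]; moving [c] towards [1/2] by the fraction [d] lands in the open
   interval. *)
pose d := D / (K + 1 + D).
have d01 : 0 < d < 1.
  by rewrite divr_gt0 ?ltr_pdivrMr//=; lra.
have dE : d * (K + 1 + D) = D by rewrite divfK// gt_eqF//; lra.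
pose t := c + d * (1 / 2 - c).
have t01 : 0 < t < 1 by rewrite /t; nra.
have := gap_lower t01; rewrite -/T.
have := lip t c.
have -> : t - c = d * (1 / 2 - c) by rewrite /t; ring.
have dist : K * `|d * (1 / 2 - c)| < D.
  rewrite normrM gtr0_norm; last lra.
  have : `|1 / 2 - c| <= 1 by rewrite ler_norml; lra.
  move=> h.
  have : K * (d * `|1 / 2 - c|) <= K * d.
    by rewrite ler_wpM2l// ler_piMr//; lra.
  have : 0 < d * D by rewrite mulr_gt0//; lra.
  nra.
by move=> h; have := le_lt_trans (le_trans (ler_norm _) h) dist; rewrite /D; lra.
Qed.

End SearchGapBounds.

(** * Exact Cover instances *)

Section SearchHamiltonian.
Variables (R : realType) (N : nat) (F : {set bits N}).
Local Open Scope complex_scope.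
Local Open Scope sesquilinear_scope.

Lemma ketF_const : ketF R F = const_mx ((Num.sqrt (#|F|%:R : R))^-1)%:C.
Proof.
apply/matrixP => j k; rewrite !mxE summxE (bigD1 (enum_val j)) ?enum_valP//=.
rewrite mxE eqxx big1 ?addr0 ?mulr1//.
by move=> x /andP[_ xj]; rewrite mxE eq_sym (negbTE xj).
Qed.

Lemma ham_CE (E : bits N -> int) (i j : 'I_#|F|) :
  ham_C R F E i j = ((E (enum_val i))%:~R * (i == j)%:R : R)%:C.
Proof.
rewrite summxE (bigD1 (enum_val i)) ?enum_valP//= big1 ?addr0 => [|x /andP[_ xi]].
  rewrite !mxE big_ord1 !mxE eqxx mul1r (inj_eq enum_val_inj) [j == i]eq_sym.
  by rewrite conjC_nat rmorphM/= rmorph_int rmorph_nat.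
by rewrite !mxE big_ord1 !mxE eq_sym (negbTE xi) mul0r mulr0.
Qed.

(** Brings the operator definition into the matrix form analysed above; the two normalizations of
    [ketF] multiply to [1 / #|F|]. *)
Lemma ham_search_ham (E : bits N -> int) (s : R) :
  ham F E s = search_ham (fun j : 'I_#|F| => (E (enum_val j))%:~R) s.
Proof.
have L0 : 0 <= (#|F|%:R : R) by rewrite ler0n.
apply/matrixP => i j; rewrite /ham /ham_R ketF_const !mxE ham_CE big_ord1 !mxE.
have cJ (x : R) : Num.conj (x%:C : R[i]) = x%:C by exact: conjc_real.
have cM (x y : R) : x%:C * y%:C = (x * y)%:C by rewrite rmorphM.
have cB (x y : R) : x%:C - y%:C = (x - y)%:C by rewrite rmorphB.
have cD (x y : R) : x%:C + y%:C = (x + y)%:C by rewrite rmorphD.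
have -> : (i == j)%:R = (i == j)%:R%:C :> R[i] by rewrite rmorph_nat.
rewrite cJ !cM cB !cM cD -invfM -expr2 sqr_sqrtr//.
by rewrite mulrA.
Qed.

Lemma inv_moment_enum (E : bits N -> int) (xs : bits N) (i0 : 'I_#|F|) k :
  enum_val i0 = xs ->
  inv_moment R F E xs k =
    #|F|%:R^-1 * \sum_(i | i != i0) ((E (enum_val i))%:~R : R) ^- k.
Proof.
move=> xsE; rewrite /inv_moment big_enum_val_cond; congr (_ * _).
by apply: eq_bigl => i; rewrite -xsE (inj_eq enum_val_inj).
Qed.

End SearchHamiltonian.

(** * Counting the feasible assignments *)

Section Counting.
Variables (N : nat).
Implicit Types (c : clause N) (x w : bits N).

Definition flip_bits w x : bits N := [ffun b => x b (+) w b].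

Lemma flip_bitsK w : involutive (flip_bits w).
Proof. by move=> x; apply/ffunP => b; rewrite !ffunE -addbA addbb addbF. Qed.

Definition clause_pattern c x : bool * bool * bool := (x (bit_i c), x (bit_j c), x (bit_k c)).

Lemma clause_cost_ge0 c x : 0 <= clause_cost c x.
Proof. exact: sqr_ge0. Qed.

Lemma clause_cost_le4 c x : clause_cost c x <= 4.
Proof. by rewrite /clause_cost; case: (x _); case: (x _); case: (x _). Qed.

Lemma clause_cost_eq0 c x : (clause_cost c x == 0) =
  (clause_pattern c x \in [:: (true, false, false); (false, true, false); (false, false, true)]).
Proof. by rewrite /clause_cost /clause_pattern; case: (x _); case: (x _); case: (x _). Qed.

(** Flipping the bits of the clause where [p] and [q] differ is an involution preserving [A] and
    exchanging the two fibers. Distinctness of the three bits lets the mask take any pattern. *)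
Lemma card_pattern_fiber c (A : {set bits N}) (p q : bool * bool * bool) :
    (forall x w, (forall b, b \notin clause_bits c -> w b = false) ->
      (flip_bits w x \in A) = (x \in A)) ->
  #|[set x in A | clause_pattern c x == p]%SET| = #|[set x in A | clause_pattern c x == q]%SET|.
Proof.
move=> Ainv.
have /and3P[ij ik jk] : [&& bit_i c != bit_j c, bit_i c != bit_k c & bit_j c != bit_k c].
  by have := clause_uniq c; rewrite /= !inE negb_or andbT -andbA.
pose w : bits N := [ffun b =>
  if b == bit_i c then p.1.1 (+) q.1.1 else
  if b == bit_j c then p.1.2 (+) q.1.2 else
  if b == bit_k c then p.2 (+) q.2 else false].
have wA x : (flip_bits w x \in A) = (x \in A).
  apply: Ainv => b; rewrite !inE !negb_or ffunE => /andP[/andP[bi bj] bk].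
  by rewrite (negbTE bi) (negbTE bj) (negbTE bk).
have pattern_flip x : clause_pattern c (flip_bits w x) =
    ((clause_pattern c x).1.1 (+) (p.1.1 (+) q.1.1),
     (clause_pattern c x).1.2 (+) (p.1.2 (+) q.1.2), (clause_pattern c x).2 (+) (p.2 (+) q.2)).
  rewrite /clause_pattern !ffunE !eqxx.
  rewrite ![bit_j c == _]eq_sym ![bit_k c == _]eq_sym.
  by rewrite (negbTE ij) (negbTE ik) (negbTE jk).
rewrite -(card_imset _ (inv_inj (flip_bitsK w))); apply: eq_card => x.
rewrite !inE; apply/imsetP/andP => [[y + ->]|[xA /eqP xq]].
  rewrite inE => /andP[yA /eqP yp]; rewrite wA; split=> //.
  by rewrite pattern_flip yp; case: p q {Ainv w wA pattern_flip yp} => [[[] []] []] [[[] []] []].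
exists (flip_bits w x); last by rewrite flip_bitsK.
rewrite inE wA xA pattern_flip xq.
by case: p q {Ainv w wA pattern_flip xq} => [[[] []] []] [[[] []] []].
Qed.

End Counting.

Lemma card_equal_fibers (T P : finType) (A : {set T}) (r : T -> P) (z : P)
    (Q : pred P) :
    (forall p, #|[set x in A | r x == p]%SET| = #|[set x in A | r x == z]%SET|) ->
  #|[set x in A | Q (r x)]%SET| = (#|Q| * #|[set x in A | r x == z]%SET|)%N.
Proof.
move=> fib.
rewrite -sum1_card (partition_big r Q) => [|x]; last by rewrite inE => /andP[].
rewrite -sum_nat_const; apply: eq_bigr => p Qp; rewrite -(fib p) -sum1_card.
apply: eq_bigl => x; rewrite !inE; case: eqP => [->|]; last by rewrite !andbF.
by rewrite !andbT (_ : Q p) ?andbT.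
Qed.

Section InstanceCounting.
Variables (N M : nat) (cl : 'I_M -> clause N).
Implicit Types (I : {set 'I_M}) (x : bits N).

Lemma mem_feasible I x :
  (x \in feasible cl I) = [forall a in I, clause_cost (cl a) x == 0].
Proof.
rewrite inE psumr_eq0 => [|a _]; last exact: clause_cost_ge0.
apply/allP/forall_inP => [h a aI|h a _]; last by apply/implyP; exact: h.
by have /implyP := h a (mem_index_enum _); exact.
Qed.

(* Flipping bits of a clause permutes its 8 patterns, 3 of which satisfy it, and
   leaves the disjoint clauses unaffected. *)
Lemma card_feasible_mul I : pairwise_disjoint cl I ->
  (#|feasible cl I| * 8 ^ #|I| = 2 ^ N * 3 ^ #|I|)%N.
Proof.
move Ek : #|I| => k; elim: k I Ek => [|k IHk] I Ek Idis.
  rewrite !expn0 !muln1 (cards0_eq Ek) -[RHS](_ : #|bits N| = _).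
    by apply: eq_card => x; rewrite mem_feasible; apply/forall_inP => a; rewrite inE.
  by rewrite card_ffun card_bool card_ord.
have [a aI] : exists a, a \in I by apply/card_gt0P; rewrite Ek.
pose J := (I :\ a)%SET.
have Jk : #|J| = k by apply/eqP; rewrite -eqSS -Ek (cardsD1 a I) aI.
have Jdis : pairwise_disjoint cl J.
  by move=> b d; rewrite !inE => /andP[_ bI] /andP[_ dI]; exact: Idis.
pose A := feasible cl J.
pose r := clause_pattern (cl a).
have Ainv x (w : bits N) : (forall b, b \notin clause_bits (cl a) -> w b = false) ->
    (flip_bits w x \in A) = (x \in A).
  move=> w0; rewrite !mem_feasible; apply: eq_forallb_in => d.
  rewrite !inE => /andP[da dI]; rewrite !clause_cost_eq0.
  have wd b : b \in clause_bits (cl d) -> flip_bits w x b = x b.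
    move=> bd; rewrite ffunE w0 ?addbF//.
    by rewrite (disjointFr (Idis d a dI aI da) bd).
  by rewrite /clause_pattern !wd// !inE eqxx ?orbT.
pose z : bool * bool * bool := (false, false, false).
have fib p : #|[set x in A | r x == p]%SET| = #|[set x in A | r x == z]%SET|.
  exact: card_pattern_fiber.
have cardP Q := card_equal_fibers Q fib.
have A8 : #|A| = (8 * #|[set x in A | r x == z]%SET|)%N.
  have := cardP predT; rewrite -{1}/A !card_prod !card_bool => <-.
  by apply: eq_card => x; rewrite inE andbT.
pose good := [:: (true, false, false); (false, true, false); (false, false, true)].
have F3 : #|feasible cl I| = (3 * #|[set x in A | r x == z]%SET|)%N.
  have good3 : #|mem good| = 3%N by apply/card_uniqP.
  rewrite -good3 -(cardP (mem good)); apply: eq_card => x.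
  rewrite [in RHS]inE /= -clause_cost_eq0 !mem_feasible.
  apply/forall_inP/andP => [h|[/forall_inP hJ ha] b bI].
    split; last exact: h.
    by apply/forall_inP => b; rewrite inE => /andP[_]; exact: h.
  have [->//|ba] := eqVneq b a.
  by apply: hJ; rewrite !inE ba.
have := IHk J Jk Jdis; rewrite -/A A8 F3 !expnS => IH.
lia.
Qed.

(** Read off the counting identity by divisibility: [8 ^ #|I|] divides [2 ^ N * 3 ^ #|I|] and is
    coprime to the power of 3. *)
Lemma leq_mul3_card I : pairwise_disjoint cl I -> (3 * #|I| <= N)%N.
Proof.
move=> /card_feasible_mul h.
have : (2 ^ (3 * #|I|) %| 2 ^ N)%N.
  rewrite -(@Gauss_dvdl _ _ (3 ^ #|I|)) ?coprimeXl ?coprimeXr//.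
  by rewrite -h expnM dvdn_mull.
by rewrite dvdn_Pexp2l.
Qed.

Lemma card_feasible I : pairwise_disjoint cl I ->
  #|feasible cl I| = (3 ^ #|I| * 2 ^ (N - 3 * #|I|))%N.
Proof.
move=> Idis; have := card_feasible_mul Idis.
have -> : (2 ^ N = 8 ^ #|I| * 2 ^ (N - 3 * #|I|))%N.
  by rewrite -(expnM 2 3) -expnD subnKC ?leq_mul3_card.
move=> h.
have p8 : (0 < 8 ^ #|I|)%N by rewrite expn_gt0.
by apply/eqP; rewrite -(eqn_pmul2r p8) h; apply/eqP; lia.
Qed.

(** Exponential growth in [N] uniformly in the number of chosen clauses: each disjoint clause
    contributes a factor [3 >= 2] for its three bits, each free bit a factor 2. *)
Lemma card_feasible_ge I : pairwise_disjoint cl I ->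
  exists2 k, (N <= 3 * k)%N & (2 ^ k <= #|feasible cl I|)%N.
Proof.
move=> Idis; exists (#|I| + (N - 3 * #|I|))%N.
  by have := leq_mul3_card Idis; lia.
rewrite (card_feasible Idis) expnD leq_mul//.
by case: #|I| => // m; rewrite leq_exp2r.
Qed.

End InstanceCounting.

(** * Bound on the maximal cost *)

Section MaxCost.
Variables (N M : nat) (cl : 'I_M -> clause N) (I : {set 'I_M}).

Lemma cost_le_max_cost x : x \in feasible cl I -> cost cl x <= max_cost cl I.
Proof. by move=> xF; rewrite /max_cost; exact: (le_bigmax_cond _ (cost cl)). Qed.

(** On feasible assignments the chosen clauses cost nothing, and every other clause costs at most
    4. *)
Lemma max_cost_le : max_cost cl I <= 4 * (M%:Z - #|I|%:Z).
Proof.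
have MI : (#|I| <= M)%N by have := max_card (mem I); rewrite card_ord.
have MIE : M%:Z - #|I|%:Z = #|~: I|%:Z.
  by have := cardsC I; rewrite card_ord; lia.
apply: bigmax_le => [|x]; first by rewrite MIE mulr_ge0.
rewrite inE => /eqP xF; rewrite /cost (bigID (mem I))/= xF add0r MIE.
apply: (@le_trans _ _ (\sum_(a | a \notin I) 4)).
  by apply: ler_sum => a _; exact: clause_cost_le4.
rewrite sumr_const (eq_card (B := mem (~: I)%SET)) => [|a]; last by rewrite !inE.
by rewrite -(natz #|_|) mulr_natr.
Qed.

End MaxCost.

(** * Inverse moments of the cost *)

Section Moments.
Variables (R : realType) (N : nat) (F : {set bits N}) (E : bits N -> int) (xs : bits N).
Hypothesis xsF : xs \in F.
Hypothesis E_ge1 : forall x, x \in F -> x != xs -> 1 <= E x.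
Local Notation L := (#|F|%:R : R).
Local Notation A k := (inv_moment R F E xs k).

Let ER x : x \in F -> x != xs -> 1 <= ((E x)%:~R : R).
Proof. by move=> xF xxs; rewrite -[1]/(1%:~R) ler_int; exact: E_ge1. Qed.

Let L_gt0 : 0 < L.
Proof. by rewrite ltr0n; apply/card_gt0P; exists xs. Qed.

Let sum1 : \sum_(x in F | x != xs) (1 : R) = L - 1.
Proof.
rewrite sumr_const (cardD1 xs F) xsF natrD addrC addKr; congr (_%:R).
by apply: eq_card => x; rewrite !inE andbC.
Qed.

Lemma inv_moment1_le1 : A 1 <= 1.
Proof.
rewrite ler_pdivrMl// mulr1; apply: (@le_trans _ _ (L - 1)); last by lra.
rewrite -sum1; apply: ler_sum => x /andP[xF xxs]; rewrite expr1 invf_le1 ?ER//.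
by apply: lt_le_trans (ER xF xxs).
Qed.

Lemma inv_moment2_le : A 2 <= A 1.
Proof.
rewrite ler_pM2l ?invr_gt0//; apply: ler_sum => x /andP[xF xxs].
have Ex := ER xF xxs.
by rewrite expr1 lef_pV2 ?posrE ?exprn_gt0//; nra.
Qed.

Lemma inv_moment_ge0 k : 0 <= A k.
Proof.
rewrite mulr_ge0 ?invr_ge0 ?(ltW L_gt0)// sumr_ge0// => x /andP[xF xxs].
by have := ER xF xxs; rewrite invr_ge0 => Ex; apply: exprn_ge0; lra.
Qed.

(** Cauchy-Schwarz, by expanding the sum of [(1 / E_x - A 1)^2]. The sum has [L - 1] terms while the
    moments divide by [L], which only helps. *)
Lemma inv_moment1_sqr_le : A 1 ^+ 2 <= A 2.
Proof.
have LA k : L * A k = \sum_(x in F | x != xs) ((E x)%:~R : R) ^- k.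
  by rewrite /inv_moment mulVKf// gt_eqF.
have LA1 := LA 1; have LA2 := LA 2; have l0 := L_gt0.
set a := A 1 in LA1 *; set b := A 2 in LA2 *.
have : 0 <= \sum_(x in F | x != xs) (((E x)%:~R : R)^-1 - a) ^+ 2.
  by apply: sumr_ge0 => x _; exact: sqr_ge0.
have -> : \sum_(x in F | x != xs) (((E x)%:~R : R)^-1 - a) ^+ 2 =
    L * b - 2 * a * (L * a) + a ^+ 2 * (L - 1).
  rewrite LA1 LA2 -sum1 !mulr_sumr -sumrB -big_split/=.
  by apply: eq_bigr => x _; rewrite expr1 -exprVn; ring.
by have := sqr_ge0 a => a0 h; rewrite -(ler_pM2l l0); lra.
Qed.

Variable r : R.
Hypothesis E_le : forall x, x \in F -> (E x)%:~R <= r.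

Lemma inv_moment_ge k : (L - 1) / (L * r ^+ k) <= A k.
Proof.
rewrite invfM mulrCA ler_pM2l ?invr_gt0// -sum1 mulr_suml.
apply: ler_sum => x /andP[xF xxs]; rewrite mul1r.
have Ex := ER xF xxs; have Er := E_le xF.
have r0 : 0 < r by lra.
have E0 : 0 < (E x)%:~R :> R by lra.
by rewrite lef_pV2 ?posrE ?exprn_gt0// lerXn2r ?nnegrE// ltW.
Qed.

End Moments.

(** * Asymptotics *)

Section InstanceGap.
Variables (R : realType) (N : nat) (F : {set bits N}) (E : bits N -> int) (xs : bits N).
Hypothesis xsF : xs \in F.
Hypothesis E_xs : E xs = 0.
Hypothesis E_ge1 : forall x, x \in F -> x != xs -> 1 <= E x.
Local Notation A k := (inv_moment R F E xs k).

Lemma ham_min_gap_attained :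
  exists2 s : R, 0 <= s <= 1 & gap (ham F E s) = min_gap (ham F E).
Proof.
have -> : ham F E = search_ham (fun j : 'I_#|F| => (E (enum_val j))%:~R : R).
  by apply/funext => s; exact: ham_search_ham.
by have [s s01 [sE _]] := min_gap_attained (fun j : 'I_#|F| => (E (enum_val j))%:~R : R);
  exists s.
Qed.

Lemma ham_min_gap_bounds (e : R) : (1 < #|F|)%N -> 0 < e -> e <= 1 / 4 ->
    e ^+ 2 * (#|F|%:R * A 2) = 1 ->
  2 * A 1 / (1 + A 1) * e * ((1 - 2 * e) / (1 + 4 * e)) <= min_gap (ham F E)
    <= 2 * A 1 / (1 + A 1) * e * (1 + e).
Proof.
have -> : ham F E = search_ham (fun j : 'I_#|F| => (E (enum_val j))%:~R : R).
  by apply/funext => s; exact: ham_search_ham.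
pose i0 := enum_rank_in xsF xs.
have i0E : enum_val i0 = xs by rewrite enum_rankK_in.
rewrite !(inv_moment_enum R E _ i0E).
move=> F1 e0 e1 eE; apply: min_gap_bounds => //; first by rewrite i0E E_xs.
move=> i ii0; rewrite -[1]/(1%:~R) ler_int; apply: E_ge1; first exact: enum_valP.
by rewrite -i0E (inj_eq enum_val_inj).
Qed.

End InstanceGap.

(** With [d] the quotient of [k] by [j], [N <= 3 j (d + 1)] and [d + 1 <= 2 ^ d]; the [j]-th power
    gives [2 ^ (d j) <= 2 ^ k]. *)
Lemma exprn_le_exp2 (j k N : nat) : (0 < j)%N -> (N <= 3 * k)%N ->
  (N ^ j <= (3 * j) ^ j * 2 ^ k)%N.
Proof.
move=> j0 Nk; have kE := divn_eq k j; set d := (k %/ j)%N in kE.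
have kd : (k <= j * d.+1)%N.
  by rewrite mulnS mulnC {1}kE addnC leq_add2r ltnW// ltn_mod.
apply: (@leq_trans ((3 * j * d.+1) ^ j)).
  by rewrite leq_exp2r//; apply: leq_trans Nk _; rewrite -mulnA leq_mul2l.
rewrite expnMn leq_mul2l; apply/orP; right.
apply: (@leq_trans ((2 ^ d) ^ j)); first by rewrite leq_exp2r// ltn_expl.
by rewrite -expnM leq_exp2l// [leqRHS]kE leq_addr.
Qed.

Lemma asymp_eq_squeeze (R : realType) (u v e : nat -> R) :
    e n @[n --> \oo] --> (0 : R) ->
    (\forall n \near \oo,
      0 < v n /\ v n * (1 - e n) <= u n <= v n * (1 + e n)) ->
  asymp_eq u v.
Proof.
move=> e0 uv; exists (fun n => u n / v n - 1); last first.
  by apply: filterS uv => n [v0 _]; rewrite addrC subrK mulrC divfK ?gt_eqF.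
apply: (@squeeze_cvgr _ _ _ _ (fun n => - e n) e); last exact: e0; last first.
  by rewrite -oppr0; exact: cvgN.
apply: filterS uv => n [v0 /andP[lo hi]].
apply/andP; split.
  by rewrite lerBrDl ler_pdivlMr// mulrC.
by rewrite lerBlDl ler_pdivrMr// mulrC.
Qed.

Unset Implicit Arguments.

(** * Asymptotics along a family of instances *)

Section Family.
Variables (R : realType) (N M : nat -> nat)
  (cl : forall n : nat, 'I_(M n) -> clause (N n))
  (I : forall n : nat, {set 'I_(M n)}) (xs : forall n : nat, bits (N n)).
Hypothesis N_oo : N n @[n --> \oo] --> \oo.
Hypothesis M_poly : poly_bounded N (fun n => (M n)%:R : R).
Hypothesis I_disj : forall n, pairwise_disjoint (cl n) (I n).
Hypothesis xs_uniq : forall n, unique_zero_cost (cl n) (I n) (xs n).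
Local Notation F n := (feasible (cl n) (I n)).
Local Notation L n := (#|F n|%:R : R).
Local Notation Rmax n := ((max_cost (cl n) (I n))%:~R : R).
Local Notation A k n := (inv_moment R (F n) (cost (cl n)) (xs n) k).
Local Notation q n :=
  (2 * A 1%N n / ((1 + A 1%N n) * Num.sqrt (A 2%N n))).

Let xsF n : xs n \in F n. Proof. by case: (xs_uniq n). Qed.

Let cost_ge1 n x : x \in F n -> x != xs n -> 1 <= cost (cl n) x.
Proof. by case: (xs_uniq n) => _ _; exact. Qed.

Let cost_le n x : x \in F n -> (cost (cl n) x)%:~R <= Rmax n.
Proof. by move=> xF; rewrite ler_int cost_le_max_cost. Qed.

Lemma card_feasibleE n : L n = 2 ^+ N n * (3 / 8) ^+ #|I n|.
Proof.
have /(congr1 (fun k => k%:R : R)) := card_feasible_mul (@I_disj n).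
rewrite !natrM !natrX => h.
have p8 : (8 : R) ^+ #|I n| != 0 by rewrite expf_neq0// pnatr_eq0.
by apply: (mulIf p8); rewrite h expr_div_n mulrA divfK.
Qed.

Lemma max_cost_leR n : Rmax n <= 4 * ((M n)%:R - #|I n|%:R).
Proof.
have := max_cost_le (cl n) (I n); rewrite -(ler_int R) => /le_trans; apply.
by rewrite rmorphM rmorphB/=.
Qed.

Lemma max_cost_ge1 n : (1 < #|F n|)%N -> 1 <= Rmax n.
Proof.
rewrite (cardsD1 (xs n)) xsF => /card_gt0P[x]; rewrite !inE => /andP[xxs xF].
have xF' : x \in F n by rewrite inE.
by apply: le_trans (cost_le _ _ xF'); rewrite -[1]/(1%:~R) ler_int cost_ge1.
Qed.

Lemma eventually_card_gt1 : \forall n \near \oo, (1 < #|F n|)%N.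
Proof.
move/cvgnyPge : N_oo => /(_ 1%N); apply: filterS => n N1.
have [k Nk] := card_feasible_ge (@I_disj n); apply: leq_trans.
by rewrite -[2%N]/(2 ^ 1)%N leq_exp2l//; lia.
Qed.

(** The upper bound comes from [A 1 <= sqrt (A 2)]. Both moments are at most 1, so
    [(1 + A 1) sqrt (A 2) <= 2] and the quotient is at least [A 1]. *)
Lemma overlap_bounds n : (L n - 1) / (L n * Rmax n) <= q n <= 2.
Proof.
have a0 := inv_moment_ge0 R (xsF n) (@cost_ge1 n) 1.
have b0 := inv_moment_ge0 R (xsF n) (@cost_ge1 n) 2.
have a1 := inv_moment1_le1 R (xsF n) (@cost_ge1 n).
have ba := inv_moment2_le R (xsF n) (@cost_ge1 n).
have ab := inv_moment1_sqr_le R (cost (cl n)) (xsF n).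
have := inv_moment_ge (xsF n) (@cost_ge1 n) (@cost_le n) 1; rewrite expr1.
move: (A 1%N n) (A 2%N n) a0 b0 a1 ba ab => a b a0 b0 a1 ba ab La.
(* A zero second moment occurs only with a single feasible state; the first moment and the quotient
   then vanish too. *)
have [bz|bz] := eqVneq b 0.
  have az : a = 0.
    by apply/eqP; rewrite -sqrf_eq0 eq_le sqr_ge0 andbT -bz.
  by rewrite az mulr0 mul0r -{1}az La ler0n.
have {}b0 : 0 < b by rewrite lt_def bz.
have s0 : 0 < Num.sqrt b by rewrite sqrtr_gt0.
have s1 : Num.sqrt b <= 1 by rewrite -(sqrtr1 R) ler_sqrt//; lra.
have sa : a <= Num.sqrt b by rewrite -[a]ger0_norm// -sqrtr_sqr ler_wsqrtr.
have d0 : 0 < (1 + a) * Num.sqrt b by rewrite mulr_gt0//; lra.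
apply/andP; split; last by rewrite ler_pdivrMr//; nra.
apply: (le_trans La); rewrite ler_pdivlMr//.
have : (1 + a) * Num.sqrt b <= 2 * 1 by apply: ler_pM => //; lra.
nra.
Qed.

Lemma poly_bounded_max_cost : poly_bounded N (fun n => Rmax n).
Proof.
have [c [d Mcd]] := M_poly; exists (4 * c)%N, d; apply: filterS Mcd => n Mn.
apply: le_trans (max_cost_leR n) _; rewrite natrM -mulrA ler_pM2l//.
by rewrite lerBlDr (le_trans Mn)// lerDl.
Qed.

Lemma inv_poly_bounded_below_overlap : inv_poly_bounded_below N (fun n => q n).
Proof.
(* The factor 2 comes from [(L - 1) / L >= 1 / 2]; the successor makes the constant positive even if
   [c = 0]. *)
have [c [d Rcd]] := poly_bounded_max_cost; exists (2 * c.+1)%N, d; split=> //.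
near=> n.
have F1 : (1 < #|F n|)%N by near: n; exact: eventually_card_gt1.
have R1 := max_cost_ge1 _ F1.
have Rn : Rmax n <= c%:R * (N n)%:R ^+ d by near: n.
have /andP[qn _] := overlap_bounds n; apply: le_trans qn.
have L2 : 2 <= L n by rewrite ler_nat.
have cN : 2 * Rmax n <= (2 * c.+1)%:R * (N n)%:R ^+ d.
  rewrite natrM -mulrA ler_pM2l// -natr1 mulrDl mul1r (le_trans Rn)// lerDl.
  by rewrite exprn_ge0.
apply: (@le_trans _ _ (2 * Rmax n)^-1).
  by rewrite lef_pV2 ?posrE//; [apply: lt_le_trans cN|]; lra.
have -> : (2 * Rmax n)^-1 = (L n / 2) / (L n * Rmax n).
  by field; rewrite !gt_eqF//; lra.
by rewrite ler_pM2r ?invr_gt0 ?mulr_gt0//; lra.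
Unshelve. all: by end_near. Qed.

(* [L] is at least [2 ^ (N / 3)], which dominates [N * Rmax ^ 2]. *)
Lemma moment_mass_grows : exists2 K : R, 0 < K
  & \forall n \near \oo, (N n)%:R <= K * (A 2 n * L n).
Proof.
have [c [d Rcd]] := poly_bounded_max_cost.
(* [j] is the exponent of [N * (N ^ d)^2], which bounds [N * Rmax^2] up to [c^2]. *)
pose j := (d + d).+1; pose K0 : R := c%:R ^+ 2 * (3 * j)%:R ^+ j.
have K00 : 0 <= K0 by rewrite mulr_ge0.
(* Doubling compensates for [L - 1] in place of [L] when [L >= 2]; adding 1 keeps the constant
   positive. *)
exists (2 * K0 + 1); first lra.
near=> n.
have F1 : (1 < #|F n|)%N by near: n; exact: eventually_card_gt1.
have R1 := max_cost_ge1 _ F1.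
have Rn : Rmax n <= c%:R * (N n)%:R ^+ d by near: n.
have L2 : 2 <= L n by rewrite ler_nat.
have [k Nk kF] := card_feasible_ge (@I_disj n).
have NL : (N n)%:R * ((N n)%:R ^+ d) ^+ 2 <= (3 * j)%:R ^+ j * L n :> R.
  rewrite -exprM muln2 -addnn -exprS -!natrX -natrM ler_nat.
  apply: leq_trans (exprn_le_exp2 (j := j) isT Nk) _.
  by rewrite leq_mul2l kF orbT.
have RN : (N n)%:R * Rmax n ^+ 2 <= K0 * L n.
  apply: (@le_trans _ _ ((N n)%:R * (c%:R * (N n)%:R ^+ d) ^+ 2)).
    by rewrite ler_wpM2l// lerXn2r// nnegrE; [lra|rewrite mulr_ge0].
  rewrite exprMn mulrCA /K0 -mulrA ler_wpM2l//.
have := inv_moment_ge (xsF n) (@cost_ge1 n) (@cost_le n) 2.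
rewrite ler_pdivrMr ?mulr_gt0 ?exprn_gt0//; try lra.
move: (A 2 n) => a h.
have R2 : 0 < Rmax n ^+ 2 by rewrite exprn_gt0//; lra.
rewrite -(ler_pM2r R2); apply: (le_trans RN).
have -> : (2 * K0 + 1) * (a * L n) * Rmax n ^+ 2 =
  (2 * K0 + 1) * (a * (L n * Rmax n ^+ 2)) by ring.
apply: le_trans (_ : (2 * K0 + 1) * (L n - 1) <= _); last by rewrite ler_wpM2l//; lra.
have : 0 <= K0 * (L n - 2) by rewrite mulr_ge0//; lra.
lra.
Unshelve. all: by end_near. Qed.

Lemma crossing_scale_cvg0 :
  (Num.sqrt (A 2 n * L n))^-1 @[n --> \oo] --> (0 : R).
Proof.
have [K K0 NK] := moment_mass_grows.
apply/cvgr0Pnorm_le => e e0.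
have Ne : \forall n \near \oo, K / e ^+ 2 <= (N n)%:R.
  move/cvgnyPge : N_oo => /(_ (Num.bound (K / e ^+ 2))); apply: filterS => n.
  rewrite -(ler_nat R); apply: le_trans; apply: ltW.
  by apply: archi_boundP; apply: divr_ge0; [exact: ltW|exact: sqr_ge0].
near=> n.
have e2 : 0 < e ^+ 2 by rewrite exprn_gt0.
have h : K / e ^+ 2 <= K * (A 2 n * L n).
  apply: (@le_trans _ _ (N n)%:R); first by near: n.
  by near: n.
rewrite ger0_norm ?invr_ge0 ?sqrtr_ge0//.
have {}h : e^-1 <= Num.sqrt (A 2 n * L n).
  move: h; rewrite ler_pM2l// => /ler_wsqrtr.
  by rewrite -exprVn sqrtr_sqr ger0_norm// invr_ge0 ltW.
have s0 : 0 < Num.sqrt (A 2 n * L n) by apply: lt_le_trans h; rewrite invr_gt0.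
by rewrite -[e]invrK lef_pV2 ?posrE ?invr_gt0.
Unshelve. all: by end_near. Qed.

Lemma min_gap_asymp :
  asymp_eq (fun n => min_gap (ham (F n) (cost (cl n)) : R -> _))
    (fun n => 2 * A 1 n / (1 + A 1 n) * (Num.sqrt (A 2 n * L n))^-1).
Proof.
pose e n := (Num.sqrt (A 2 n * L n))^-1.
have e0 := crossing_scale_cvg0.
have e4 : \forall n \near \oo, e n <= 1 / 4.
  have /cvgr0Pnorm_le/(_ (1 / 4) ltac:(lra)) := e0.
  by apply: filterS => n; apply: le_trans; exact: ler_norm.
(* The constant 6 works since [(1 - 6 e) (1 + 4 e) <= 1 - 2 e]; the upper bound needs only
   [1 + e]. *)
apply: (@asymp_eq_squeeze _ _ _ (fun n => 6 * e n)).
  by rewrite -(mulr0 (6 : R)); apply: cvgM => //; exact: cvg_cst.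
near=> n.
have F1 : (1 < #|F n|)%N by near: n; exact: eventually_card_gt1.
have L2 : 2 <= L n by rewrite ler_nat.
have R1 := max_cost_ge1 _ F1.
have A0 k : 0 < A k n.
  apply: lt_le_trans (inv_moment_ge (xsF n) (@cost_ge1 n) (@cost_le n) k).
  by rewrite divr_gt0 ?mulr_gt0 ?exprn_gt0//; lra.
have AL0 : 0 < A 2 n * L n by rewrite mulr_gt0//; lra.
have en0 : 0 < e n by rewrite invr_gt0 sqrtr_gt0.
have en4 : e n <= 1 / 4 by near: n.
have eE : e n ^+ 2 * (L n * A 2 n) = 1.
  by rewrite /e exprVn sqr_sqrtr ?ltW// [L n * _]mulrC mulVf// gt_eqF.
have cxs : cost (cl n) (xs n) = 0 by case: (xs_uniq n).
have := ham_min_gap_bounds (xsF n) cxs (@cost_ge1 n) F1 en0 en4 eE.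
rewrite -/(e n); have := A0 1%N; move: (A 1 n) => a a0.
set T := 2 * a / (1 + a) * e n.
have T0 : 0 < T by rewrite /T mulr_gt0// divr_gt0 ?mulr_gt0//; lra.
move=> /andP[lo hi]; split=> //; apply/andP; split.
  apply: le_trans lo; rewrite ler_pM2l// ler_pdivlMr; last lra.
  have : 0 <= e n * e n by rewrite mulr_ge0 ?ltW.
  lra.
by apply: (le_trans hi); rewrite ler_pM2l//; lra.
Unshelve. all: by end_near. Qed.

(** The product of the two powers is [1 / sqrt L]: it is nonnegative and its square is [1 / L] by
    the count of feasible states. *)
Lemma crossing_scaleE n :
  2 * A 1 n / (1 + A 1 n) * (Num.sqrt (A 2 n * L n))^-1 =
  q n * 2 `^ (- ((N n)%:R / 2)) * (8 / 3) `^ (#|I n|%:R / 2).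
Proof.
set p := 2 `^ (- ((N n)%:R / 2)); set r := (8 / 3) `^ _.
have half (x : R) k : 0 <= x -> (x `^ (k%:R / 2)) ^+ 2 = x ^+ k.
  by move=> x0; rewrite -powR_mulrn ?powR_ge0// -powRrM divfK// powR_mulrn.
have pr0 : 0 <= p * r by rewrite mulr_ge0 ?powR_ge0.
have prE : (p * r) ^+ 2 = (L n)^-1.
  rewrite exprMn /p powRN exprVn !half ?divr_ge0//.
  by rewrite card_feasibleE invfM; congr (_ * _); rewrite -exprVn invf_div.
have -> : (Num.sqrt (A 2 n * L n))^-1 = (Num.sqrt (A 2 n))^-1 * (p * r).
  rewrite sqrtrM ?(inv_moment_ge0 R (xsF n) (@cost_ge1 n))//.
  rewrite invfM; congr (_ * _).
  by rewrite -sqrtrV// -prE sqrtr_sqr ger0_norm.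
by rewrite invfM; ring.
Qed.

End Family.

Theorem theoremD1 (R : realType)
  (N M : nat -> nat)
  (cl : forall n : nat, 'I_(M n) -> clause (N n))
  (I : forall n : nat, {set 'I_(M n)})
  (xs : forall n : nat, bits (N n))
  (N_oo : N n @[n --> \oo] --> \oo)
  (M_poly : poly_bounded N (fun n => (M n)%:R : R))
  (I_disj : forall n, pairwise_disjoint (cl n) (I n))
  (xs_uniq : forall n, unique_zero_cost (cl n) (I n) (xs n)) :
  let m n := #|I n| in
  let F n := feasible (cl n) (I n) in
  let E n := cost (cl n) in
  let L n : R := #|F n|%:R in
  let Rmax n : R := (max_cost (cl n) (I n))%:~R in
  let H n (s : R) := ham (F n) (E n) s in
  let A k n : R := inv_moment R (F n) (E n) (xs n) k in
  let gmin n : R := min_gap (H n) in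
  let q n : R := 2 * A 1%N n / ((1 + A 1%N n) * Num.sqrt (A 2%N n)) in
  [/\ forall n, L n = 2 ^+ N n * (3 / 8) ^+ m n,
      forall n, exists2 s : R, 0 <= s <= 1 & gap (H n s) = gmin n,
      asymp_eq gmin (fun n =>
        2 * A 1%N n / (1 + A 1%N n) * (Num.sqrt (A 2%N n * L n))^-1),
      asymp_eq gmin (fun n =>
        q n * 2 `^ (- ((N n)%:R / 2)) * (8 / 3) `^ ((m n)%:R / 2))
    & [/\ forall n, (L n - 1) / (L n * Rmax n) <= q n <= 2,
          forall n, Rmax n <= 4 * ((M n)%:R - (m n)%:R),
          poly_bounded N Rmax
        & inv_poly_bounded_below N q]].
Proof.
move=> m F E L Rmax H A gmin q; split.
- move=> n; exact: card_feasibleE.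
- move=> n; have [xsF _ _] := xs_uniq n; exact: ham_min_gap_attained.
- exact: min_gap_asymp.
- have -> : (fun n => q n * 2 `^ (- ((N n)%:R / 2)) * (8 / 3) `^ ((m n)%:R / 2)) =
      (fun n => 2 * A 1%N n / (1 + A 1%N n) * (Num.sqrt (A 2%N n * L n))^-1).
    by apply/funext => n; rewrite -crossing_scaleE.
  exact: min_gap_asymp.
- split.
  + move=> n; exact: overlap_bounds.
  + move=> n; exact: max_cost_leR.
  + exact: poly_bounded_max_cost.
  + exact: inv_poly_bounded_below_overlap.
Qed.
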